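(* Let $d\ge 1$, let $\gamma,p\in\mathbb{R}$ with $\gamma+2p<1$, and let $0<c_1\le c_2<\infty$. Suppose that $K:\mathbb{N}^d_*\times\mathbb{N}^d_*\to\mathbb{R}_+$, $(\alpha,\beta)\mapsto K_{\alpha,\beta}$, is symmetric and satisfies $$c_1(|\alpha|+|\beta|)^{\gamma}\,\Phi\!\left(\tfrac{|\alpha|}{|\alpha|+|\beta|}\right)\le K_{\alpha,\beta}\le c_2(|\alpha|+|\beta|)^{\gamma}\,\Phi\!\left(\tfrac{|\alpha|}{|\alpha|+|\beta|}\right),\qquad \alpha,\beta\in\mathbb{N}^d_*,$$ where $\Phi(s)=s^{-p}(1-s)^{-p}$ for $0<s<1$. Let $\{s_\alpha\}_{\alpha\in\mathbb{N}^d_*}$ be a non-negative sequence supported on a finite number of values $\alpha$. Then there exists a (discrete) stationary injection solution $\{n_\alpha\}_{\alpha\in\mathbb{N}^d_*}$ (with kernel $K$, parameters $(\gamma,p)$ and source $\{s_\alpha\}$).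
   Context: Notation: $\mathbb{N}_0=\{0,1,2,\dots\}$, $O=(0,\dots,0)$, $\mathbb{N}^d_*=\mathbb{N}_0^d\setminus\{O\}$, $\mathbb{R}^d_*=[0,\infty)^d\setminus\{O\}$, $\mathbb{R}_+=[0,\infty)$, and $|\alpha|=\sum_{j=1}^d\alpha_j$. $C^1_c(\mathbb{R}^d_* )$ denotes the $C^1$ functions with compact support in $\mathbb{R}^d_*$. Definition (discrete stationary injection solution with kernel $K$, parameters $(\gamma,p)$, source $\{s_\alpha\}$). This is a sequence $\{n_\alpha\}_{\alpha\in\mathbb{N}^d_*}$ with $n_\alpha\ge 0$, $\sum_{\alpha\in\mathbb{N}^d_*}|\alpha|^{\gamma+p}n_\alpha<\infty$, and such that the measure $f=\sum_\alpha n_\alpha\delta(\cdot-\alpha)$ solves the stationary coagulation equation with source $\eta=\sum_\alpha s_\alpha\delta(\cdot-\alpha)$ in weak form, i.e. for every $\varphi\in C^1_c(\mathbb{R}^d_* )$ $$0=\frac12\sum_{\alpha\in\mathbb{N}^d_*}\sum_{\beta\in\mathbb{N}^d_*}K_{\alpha,\beta}\,[\varphi(\alpha+\beta)-\varphi(\alpha)-\varphi(\beta)]\,n_\alpha n_\beta+\sum_{\alpha\in\mathbb{N}^d_*}\varphi(\alpha)s_\alpha .$$ (This is the weak form of $0=\frac12\sum_{\beta<\alpha}K_{\alpha-\beta,\beta}n_{\alpha-\beta}n_\beta-n_\alpha\sum_{\beta>0}K_{\alpha,\beta}n_\beta+s_\alpha$, where $\beta<\alpha$ means $\beta\le\alpha$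 componentwise and $\beta\ne\alpha$.) *)

(* Defs.v *)
From HB Require Import structures.
From mathcomp Require Import all_boot all_order all_algebra.
From mathcomp Require Import all_classical all_reals all_analysis.

Set Implicit Arguments.
Unset Strict Implicit.
Unset Printing Implicit Defensive.

Import Order.TTheory GRing.Theory Num.Theory.
Import numFieldNormedType.Exports.

Local Open Scope classical_set_scope.
Local Open Scope ring_scope.

Definition Nstar (d : nat) : set 'rV[nat]_d := [set a | a != 0].
Arguments Nstar : clear implicits.

Definition size1 (d : nat) (a : 'rV[nat]_d) : nat := (\sum_(j < d) a 0%R j)%N.

Definition lattice_pt (R : realType) (d : nat) (a : 'rV[nat]_d) : 'rV[R]_d :=
  \row_j (a 0 j)%:R.

Definition Rstar (R : realType) (d : nat) : set 'rV[R]_d :=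
  [set x | (forall j, 0 <= x 0 j) /\ x != 0].
Arguments Rstar : clear implicits.

(* [Rstar] is not open in R^d: a function is C^1 on such a set A when it is the
   restriction to A of a C^1 function on an open neighbourhood of A, so the
   total function f below must be C^1 near every point of A. *)
Definition C1_on (R : realType) (d : nat) (A : set 'rV[R]_d)
    (f : 'rV[R]_d -> R) : Prop :=
  exists U : set 'rV[R]_d, [/\ open U, A `<=` U &
    forall x, U x -> differentiable f x /\
      forall v : 'rV[R]_d, {for x, continuous (fun y => 'D_v f y)}].

(* The support is taken relatively to A: the values of f off A are irrelevant.
   Inclusion of the closure in A keeps the support away from the origin when
   A = Rstar. *)
Definition compact_support_in (R : realType) (d : nat) (A : set 'rV[R]_d)
    (f : 'rV[R]_d -> R) : Prop :=
  let S := closure [set x | A x /\ f x != 0] in compact S /\ S `<=` A.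

Definition C1c_Rstar (R : realType) (d : nat) (f : 'rV[R]_d -> R) : Prop :=
  C1_on (Rstar R d) f /\ compact_support_in (Rstar R d) f.

(* Sum of a real family; meaningful when the family is absolutely summable. *)
Definition rsum (R : realType) (T : choiceType) (D : set T) (f : T -> R) : R :=
  fine (esum D (EFin \o f)^\+ - esum D (EFin \o f)^\-)%E.

Definition coag_term (R : realType) (d : nat)
    (K : 'rV[nat]_d -> 'rV[nat]_d -> R) (n : 'rV[nat]_d -> R)
    (phi : 'rV[R]_d -> R) (ab : 'rV[nat]_d * 'rV[nat]_d) : R :=
  let: (a, b) := ab in
  K a b * (phi (lattice_pt R (a + b)) - phi (lattice_pt R a)
           - phi (lattice_pt R b)) * n a * n b.

(* Absolute summability is what gives the double series its value; the source
   sum has finite support because phi has compact support in Rstar. *)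
Definition weak_equation (R : realType) (d : nat)
    (K : 'rV[nat]_d -> 'rV[nat]_d -> R) (s n : 'rV[nat]_d -> R)
    (phi : 'rV[R]_d -> R) : Prop :=
  summable (Nstar d `*` Nstar d) (EFin \o coag_term K n phi) /\
  0 = 2^-1 * rsum (Nstar d `*` Nstar d) (coag_term K n phi)
      + \sum_(a \in Nstar d) phi (lattice_pt R a) * s a.

Definition stationary_injection_solution (R : realType) (d : nat)
    (K : 'rV[nat]_d -> 'rV[nat]_d -> R) (gamma p : R)
    (s n : 'rV[nat]_d -> R) : Prop :=
  [/\ forall a, Nstar d a -> 0 <= n a,
      (\esum_(a in Nstar d) ((size1 a)%:R `^ (gamma + p) * n a)%:E < +oo)%E &
      forall phi : 'rV[R]_d -> R, C1c_Rstar phi -> weak_equation K s n phi].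

Definition Phi (R : realType) (p x : R) : R := x `^ (- p) * (1 - x) `^ (- p).

(* (|a| + |b|)^gamma Phi(|a| / (|a| + |b|)) *)
Definition kernel_bound (R : realType) (d : nat) (gamma p : R)
    (a b : 'rV[nat]_d) : R :=
  let m := (size1 a)%:R + (size1 b)%:R in
  m `^ gamma * Phi p ((size1 a)%:R / m).

(* Main.v *)
(** On the lattice ball |a| <= 2^N the truncated stationary system is a finite
    quadratic system whose residual points inwards on the faces of a suitable
    box, so a Poincare-Miranda argument gives approximate solutions.  That
    argument rests on a discrete degree: on the grid (Z/k)^n, the parity of the
    number of Kuhn chains v_0, ..., v_n whose j-th edge is detected by the j-th
    of n closed 1-cochains over F_2 does not change when a cochain is
    modified by a coboundary.

    Testing the truncated system with |a| cut off at 2^k bounds the flux of mass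
    through size 2^k by the injected mass.  Pairs of clusters with sizes in
    (2^(k-1), 2^k] cross that size, so the number of such clusters is
    O(2^(-k(gamma+1)/2)) and their moment of order gamma + p is
    O(2^(k(gamma+2p-1)/2)), a summable geometric sequence since gamma + 2p < 1.
    These bounds are uniform in N, so limits along an ultrafilter satisfy the
    weak equation. *)
Require Import Defs.
From HB Require Import structures.
From mathcomp Require Import all_boot all_order all_fingroup all_algebra.
From mathcomp Require Import all_classical all_reals all_analysis.
From mathcomp Require Import lra ring zify.

Set Implicit Arguments.
Unset Strict Implicit.
Unset Printing Implicit Defensive.

Import Order.TTheory GRing.Theory Num.Theory.
Import numFieldNormedType.Exports.

Local Open Scope classical_set_scope.
Local Open Scope ring_scope.

(** * A mod 2 degree on the discrete torus *)

Section TorusChains.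
Variables (n' k : nat).
Local Notation n := n'.+1.
Local Notation V := {ffun 'I_n -> 'I_k.+2}.

(** The type ['I_k.+2] carries addition modulo k + 2, so [V] is a torus: steps wrap around, and sums
    over all vertices are invariant under translation. *)
Definition basis_step (c : 'I_n) : V := [ffun i => (i == c)%:R].

Definition chain_dir (s : 'S_n) (t : nat) : 'I_n := s (inord t).

(** Vertices of the Kuhn chain from [q] that takes one unit step in each direction, in the order
    given by [s]. *)
Definition chain_vertex (q : V) (s : 'S_n) (t : nat) : V :=
  q + \sum_(0 <= i < t) basis_step (chain_dir s i).

(** Over ['F_2] closedness needs no signs: the two routes across each coordinate square have equal
    sums. *)
Definition closed_cochain (A : V -> 'I_n -> 'F_2) :=
  forall u c c', A u c + A (u + basis_step c) c' =
                 A u c' + A (u + basis_step c') c.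

Lemma addF2 (x : 'F_2) : x + x = 0.
Proof. by apply: (addrr_pchar2 (pchar_Fp _)). Qed.

Lemma F2_eq (x y : 'F_2) : x + y = 0 -> x = y.
Proof. by move=> /(congr1 (+%R^~ y)); rewrite -addrA addF2 addr0 add0r. Qed.

(** Left multiplication by a transposition exchanges even and odd permutations, so the sum consists
    of two equal halves, which cancel mod 2. *)
Lemma sum_swap_invariant (F : 'S_n -> 'F_2) (a b : 'I_n) : a != b ->
  (forall s, F (tperm a b * s)%g = F s) -> \sum_s F s = 0.
Proof.
move=> ab Fs; rewrite (bigID (fun s : 'S_n => odd_perm s)) /=.
set x := \sum_(s | _) _; set y := \sum_(s | _) _.
have -> : x = y; last exact: addF2.
rewrite /x (reindex_inj (mulgI (tperm a b))) /=.
by apply: eq_big => s *; rewrite ?odd_mul_tperm ?ab ?addTb ?Fs.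
Qed.

Lemma chain_vertexS q s t :
  chain_vertex q s t.+1 = chain_vertex q s t + basis_step (chain_dir s t).
Proof. by rewrite /chain_vertex big_nat_recr //= addrA. Qed.

(** The left factor of a product of permutations acts first, so the transposition permutes positions
    in the chain rather than directions. *)
Lemma chain_dir_swap (s : 'S_n) g t : (g < n')%N -> (t < n)%N ->
  chain_dir (tperm (inord g) (inord g.+1) * s)%g t =
  if t == g then chain_dir s g.+1 else
  if t == g.+1 then chain_dir s g else chain_dir s t.
Proof.
move=> gn tn; rewrite /chain_dir permM.
case: eqP => [->|tg]; first by rewrite tpermL.
case: eqP => [->|tg']; first by rewrite tpermR.
rewrite tpermD //; apply/eqP => /(congr1 val); rewrite /= !inordK ?ltnS //.
- by move=> e; apply: tg.
- exact: ltnW.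
- by move=> e; apply: tg'.
Qed.

Lemma chain_vertex_swap q (s : 'S_n) g t : (g < n')%N -> (t <= n)%N ->
  t != g.+1 ->
  chain_vertex q (tperm (inord g) (inord g.+1) * s)%g t = chain_vertex q s t.
Proof.
move=> gn; case: (leqP t g) => [tg tn _|gt tn tg].
  congr (_ + _); apply: eq_big_nat => i /andP[_ it].
  have ig := leq_trans it tg.
  rewrite chain_dir_swap ?(leq_trans it tn)//.
  by rewrite (ltn_eqF ig) (ltn_eqF (ltnW ig : (i < g.+1)%N)).
have {gt tg} : (g.+2 <= t)%N by rewrite ltn_neqAle eq_sym tg.
elim: t tn => // t IH tn; rewrite ltnS leq_eqVlt => /predU1P[<-|gt].
  rewrite !chain_vertexS.
  have -> : chain_vertex q (tperm (inord g) (inord g.+1) * s)%g g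
         = chain_vertex q s g.
    congr (_ + _); apply: eq_big_nat => i /andP[_ it].
    rewrite chain_dir_swap ?(ltn_trans it)//; last exact: ltnW.
    by rewrite (ltn_eqF it) (ltn_eqF (ltnW it : (i < g.+1)%N)).
  rewrite !chain_dir_swap ?ltnS ?eqxx //; last exact: ltnW.
  by rewrite (gtn_eqF (ltnSn g)) addrAC.
rewrite !chain_vertexS IH ?(ltnW tn)// chain_dir_swap //.
by rewrite gtn_eqF ?(ltnW gt)// gtn_eqF.
Qed.

(* The factors [A 0, A 1, ...] sit in order on the edges of the chain other
   than the edge [g]. *)
Definition gap_sum (h : V -> 'F_2) (A : nat -> V -> 'I_n -> 'F_2) (t g : nat) :=
  \sum_q \sum_s h (chain_vertex q s t) *
    \prod_(i < n') A i (chain_vertex q s (bump g i)) (chain_dir s (bump g i)).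

(* Exchanging the steps [g] and [g.+1] of a chain moves only the vertex [g.+1];
   closedness of [A g] makes the sum of the two products invariant under this
   exchange, so the contributions cancel in pairs. *)
Lemma gap_sum_step h A t g : (g < n')%N -> (t <= n)%N -> t != g.+1 ->
  closed_cochain (A g) -> gap_sum h A t g = gap_sum h A t g.+1.
Proof.
move=> gn tn tg Ag; apply: F2_eq; rewrite -big_split /=.
apply: big1 => q _; rewrite -big_split /=.
have gg : (inord g : 'I_n) != inord g.+1.
  by apply/eqP => /(congr1 val); rewrite /= !inordK ?ltnS ?(ltnW gn)// => /n_Sn.
apply: (sum_swap_invariant gg) => s.
(* The two products share every factor except that of [A g], which sits on edge [g.+1] when the gap
   is at [g] and on edge [g] when it is at [g.+1]. *)
have F s' : h (chain_vertex q s' t) * (\prod_(i < n')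
      A i (chain_vertex q s' (bump g i)) (chain_dir s' (bump g i))) +
    h (chain_vertex q s' t) * (\prod_(i < n')
      A i (chain_vertex q s' (bump g.+1 i)) (chain_dir s' (bump g.+1 i))) =
  h (chain_vertex q s' t) * (\prod_(i < n' | i != Ordinal gn)
      A i (chain_vertex q s' (bump g i)) (chain_dir s' (bump g i))) *
   (A g (chain_vertex q s' g) (chain_dir s' g) +
    A g (chain_vertex q s' g + basis_step (chain_dir s' g)) (chain_dir s' g.+1)).
  rewrite (bigD1 (Ordinal gn)) //= [X in _ + _ * X](bigD1 (Ordinal gn)) //=.
  have -> : bump g g = g.+1 by rewrite /bump leqnn.
  have -> : bump g.+1 g = g by rewrite /bump ltnn.
  rewrite -chain_vertexS (eq_bigr (fun i : 'I_n' =>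
     A i (chain_vertex q s' (bump g.+1 i)) (chain_dir s' (bump g.+1 i)))).
    by rewrite -mulrDr -mulrA; congr (_ * _); rewrite -mulrDl mulrC addrC.
  move=> i ig; have iE : (i : nat) != g by [].
  by have -> : bump g i = bump g.+1 i by rewrite /bump; lia.
rewrite !F chain_vertex_swap //; congr (_ * _ * _).
  apply: eq_bigr => i /eqP ig.
  have iE : (i : nat) != g by apply/eqP => e; case: ig; exact/val_inj.
  have bn : (bump g i < n)%N.
    by rewrite /bump; case: (g <= i)%N; rewrite ?add1n ?add0n ?ltnS // ltnW.
  have bg : bump g i != g by rewrite eq_sym neq_bump.
  have bg1 : bump g i != g.+1.
    rewrite /bump; case: leqP => /= h1; rewrite ?add1n ?eqSS //.
    by rewrite add0n ltn_eqF // ltnW.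
  by rewrite chain_vertex_swap ?(ltnW bn)// chain_dir_swap // (negPf bg) (negPf bg1).
rewrite !chain_dir_swap ?ltnS ?(ltnW gn)// eqxx gtn_eqF // eqxx.
have gn' : (g <= n)%N by rewrite ltnW // ltnW.
have gg' : g != g.+1 by rewrite ltn_eqF.
by rewrite (@chain_vertex_swap q s g g gn gn' gg') Ag.
Qed.

(** Moving the first step of a chain to its end, and the base point along that step, is a bijection
    of chains. It renumbers edge i + 1 as edge i, so a gap at the first edge becomes a gap at the
    last one. *)
Lemma gap_sum_shift h A t : (t <= n')%N ->
  gap_sum h A t.+1 0 = gap_sum h A t n'.
Proof.
move=> tn; rewrite /gap_sum exchange_big [RHS]exchange_big /=.
pose r := perm (@ordS_inj n).
rewrite [RHS](reindex_inj (mulgI r)) /=; apply: eq_bigr => s _.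
rewrite [RHS](reindex_inj (addIr (basis_step (s ord0)))) /=.
have dirE i : (i < n')%N -> chain_dir (r * s)%g i = chain_dir s i.+1.
  move=> i_n; rewrite /chain_dir permM permE; congr (s _); apply: val_inj => /=.
  by rewrite inordK ?inordK ?modn_small ?ltnS// ltnW.
have vE q i : (i <= n')%N ->
    chain_vertex (q + basis_step (s ord0)) (r * s)%g i = chain_vertex q s i.+1.
  rewrite /chain_vertex big_nat_recl // addrA => i_n; congr (_ + _).
    by congr (_ + basis_step (s _)); apply: val_inj; rewrite /= inordK.
  by apply: eq_big_nat => j /andP[_ ji]; rewrite dirE // (leq_trans ji).
apply: eq_bigr => q _; rewrite vE //; congr (_ * _); apply: eq_bigr => i _.
have -> : bump n' i = i by rewrite /bump leqNgt ltn_ord.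
by rewrite vE 1?ltnW // dirE.
Qed.

(** The cup product of the cochains evaluated on the fundamental class of the torus, whose top
    simplices are the Kuhn chains. *)
Definition chain_sum (B : nat -> V -> 'I_n -> 'F_2) :=
  \sum_q \sum_s \prod_(i < n) B i (chain_vertex q s i) (chain_dir s i).

Definition coboundary (h : V -> 'F_2) u c := h (u + basis_step c) + h u.

Lemma closed_coboundary h : closed_cochain (coboundary h).
Proof.
move=> u c c'; rewrite /coboundary [u + _ + basis_step c]addrAC.
set x := h (_ + _ + _); rewrite -(addrC (h u)) -(addrC (h u)) -!addrA; congr (_ + _).
by rewrite addrC -addrA addF2 [RHS]addrC -addrA addF2.
Qed.

(* The two terms of [coboundary h] leave a gap at the edge [j]; it slides to the
   first edge in one of them and to the last edge in the other, and a cyclic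
   shift of the steps identifies the results. *)
Lemma chain_sum_coboundary B h j : (j < n)%N ->
  (forall i, i != j -> closed_cochain (B i)) ->
  (forall u c, B j u c = coboundary h u c) -> chain_sum B = 0.
Proof.
move=> jn clB Bj.
pose A i := B (bump j i).
have -> : chain_sum B = gap_sum h A j.+1 j + gap_sum h A j j.
  rewrite /gap_sum -big_split; apply: eq_bigr => q _ /=.
  rewrite -big_split; apply: eq_bigr => s _ /=.
  rewrite -mulrDl (bigD1_ord (Ordinal jn)) //= Bj /coboundary -chain_vertexS.
  by congr (_ * _); apply: eq_bigr => i _.
have clA i : closed_cochain (A i) by apply: clB; rewrite eq_sym neq_bump.
have L g : (g <= j)%N -> gap_sum h A j.+1 0 = gap_sum h A j.+1 g.
  elim: g => // g IH gj; rewrite IH ?(ltnW gj)// gap_sum_step //.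
  - by apply: leq_trans gj _; rewrite -ltnS.
  - by rewrite eqSS gtn_eqF.
have R m : (j + m <= n')%N -> gap_sum h A j j = gap_sum h A j (j + m).
  elim: m => [|m IH]; first by rewrite addn0.
  rewrite addnS => jm; rewrite IH ?(ltnW jm)// gap_sum_step //.
  - exact: ltnW.
  - by rewrite ltn_eqF // ltnS leq_addr.
rewrite -L // gap_sum_shift ?(R (n' - j)%N) ?subnKC ?addF2 //.
Qed.

(* Dual to the coordinate circle [i]: supported on the edges in direction [i]
   that close up the torus, hence closed but not a coboundary. *)
Definition wrap_cochain (i : nat) (u : V) (c : 'I_n) : 'F_2 :=
  (((c : nat) == i) && (u c == ord_max))%:R.

Lemma closed_wrap_cochain i : closed_cochain (wrap_cochain i).
Proof.
move=> u c c'; rewrite /wrap_cochain !ffunE.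
case: (eqVneq (c : nat) i) => ci; case: (eqVneq (c' : nat) i) => ci' //=.
- by have -> : c = c' by apply: val_inj; rewrite /= ci.
- rewrite addr0 add0r; have /negPf-> : c != c' by apply: contraNneq ci' => <-; apply/eqP.
  by rewrite addr0.
- rewrite addr0 add0r; have /negPf-> : c' != c by apply: contraNneq ci => <-; apply/eqP.
  by rewrite addr0.
Qed.

(** A nonzero product forces step i into direction i, so the order is the identity. Coordinate i is
    then untouched before step i, and wrapping there means that it starts at its maximum. Exactly
    one chain remains. *)
Lemma chain_sum_wrap : chain_sum wrap_cochain = 1.
Proof.
rewrite /chain_sum (bigD1 ([ffun => ord_max] : V)) //= (bigD1 (1%g : 'S_n)) //=.
have vE (q : V) (i : 'I_n) : chain_vertex q 1%g i i = q i.
  rewrite ffunE sum_ffunE big_nat big1 ?addr0 // => j /andP[_ ji].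
  rewrite ffunE /chain_dir perm1; case: eqP => // /(congr1 val) /=.
  rewrite inordK ?(ltn_trans ji)// => e.
  by rewrite e ltnn in ji.
have dE (i : 'I_n) : chain_dir 1%g i = i.
  by rewrite /chain_dir perm1; apply: val_inj; rewrite /= inordK.
rewrite big1 => [|i _]; last by rewrite /wrap_cochain dE vE ffunE !eqxx.
have dne (s : 'S_n) : s != 1%g -> exists i : 'I_n, chain_dir s i != i.
  move=> s1; apply/existsP; move: s1; apply: contraR.
  rewrite negb_exists => /forallP s1.
  apply/eqP/permP => i; have := s1 i; rewrite negbK => /eqP {2}<-.
  by rewrite perm1 /chain_dir; congr (s _); apply: val_inj; rewrite /= inordK.
have sne (q : V) (s : 'S_n) : s != 1%g -> \prod_(i < n)
   wrap_cochain i (chain_vertex q s i) (chain_dir s i) = 0.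
  move=> /dne[i si]; apply/eqP; rewrite prodf_seq_eq0; apply/hasP.
  exists i; first exact: mem_index_enum.
  by rewrite /= /wrap_cochain (_ : (_ == _ :> nat) = false) //; apply/negbTE.
rewrite big1 => [|s s1]; last exact: sne.
rewrite addr0 big1 ?addr0 // => q q1; apply: big1 => s _.
have [->|] := eqVneq s 1%g; last exact: sne.
have [i qi] : exists i : 'I_n, q i != ord_max.
  apply/existsP; move: q1; apply: contraR.
  rewrite negb_exists => /forallP s1.
  by apply/eqP/ffunP => i; have := s1 i; rewrite negbK ffunE => /eqP.
apply/eqP; rewrite prodf_seq_eq0; apply/hasP; exists i; first exact: mem_index_enum.
by rewrite /= /wrap_cochain dE vE (negPf qi) andbF.
Qed.

(** The cochains are modified one index at a time: [C t] carries the first t coboundaries. By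
    multilinearity consecutive sums differ by a chain sum with one coboundary factor, which
    vanishes. *)
Lemma chain_sum_cohomologous (h : nat -> V -> 'F_2) :
  chain_sum (fun i u c => wrap_cochain i u c + coboundary (h i) u c) = 1.
Proof.
pose C t i u c :=
  wrap_cochain i u c + (if (i < t)%N then coboundary (h i) u c else 0).
have clC t i : closed_cochain (C t i).
  move=> u c c'; rewrite /C.
  case: ifP => _; last by rewrite !addr0 closed_wrap_cochain.
  by rewrite !(addrACA _ (coboundary _ _ _)) closed_wrap_cochain closed_coboundary.
have E t : (t <= n)%N -> chain_sum (C t) = 1.
  elim: t => [_|t IH tn].
    rewrite -chain_sum_wrap; apply: eq_bigr => q _; apply: eq_bigr => s _.
    by apply: eq_bigr => i _; rewrite /C addr0.
  rewrite -(IH (ltnW tn)); apply: F2_eq.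
  rewrite -(@chain_sum_coboundary
    (fun i u c => if i == t then coboundary (h t) u c else C t i u c) (h t) t) //.
  - rewrite -big_split; apply: eq_bigr => q _ /=.
    rewrite -big_split; apply: eq_bigr => s _ /=.
    rewrite (bigD1 (Ordinal tn)) //= [X in _ + X](bigD1 (Ordinal tn)) //=.
    rewrite [RHS](bigD1 (Ordinal tn)) //= eqxx.
    have R (i : 'I_n) : i != Ordinal tn ->
        (((i : nat) == t) = false) * ((i < t.+1)%N = (i < t)%N).
      move=> it; have it' : (i : nat) != t by [].
      by rewrite ltnS leq_eqVlt (negPf it').
    rewrite (eq_bigr (fun i : 'I_n => C t i (chain_vertex q s i) (chain_dir s i))).
      rewrite -mulrDl [in RHS](eq_bigr
        (fun i : 'I_n => C t i (chain_vertex q s i) (chain_dir s i))).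
        by congr (_ * _); rewrite /C ltnSn ltnn addr0 addrAC addF2 add0r.
      by move=> i /R[-> _].
    by move=> i /R[_ e]; rewrite /C e.
  - by move=> i /negPf it u c c'; rewrite it; apply: clC.
  - by move=> u c; rewrite eqxx.
rewrite -(E n (leqnn _)); apply: eq_bigr => q _; apply: eq_bigr => s _.
by apply: eq_bigr => i _; rewrite /C ltn_ord.
Qed.

(** The label cochains differ from the wrap cochains by coboundaries, so the parity is odd and some
    chain has [B j] nonzero on its j-th edge for every j. The face conditions keep this chain from
    wrapping around; it therefore stays in one cell, and label j changes along edge j. *)
Lemma discrete_poincare_miranda (lab : V -> 'I_n -> bool) :
  (forall (u : V) j, u j = ord0 -> lab u j = false) ->
  (forall (u : V) j, u j = ord_max -> lab u j = true) ->
  exists q : V, forall j, exists v w : V,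
    [/\ lab v j = false, lab w j = true,
        forall i, (q i <= v i <= (q i).+1)%N &
        forall i, (q i <= w i <= (q i).+1)%N].
Proof.
move=> lab0 lab1.
pose h i (u : V) : 'F_2 := (lab u (inord i))%:R.
pose B i u c := wrap_cochain i u c + coboundary (h i) u c.
have [q [s Bq]] : exists q s, forall i : 'I_n,
    B i (chain_vertex q s i) (chain_dir s i) != 0.
  have : chain_sum B != 0 by rewrite chain_sum_cohomologous.
  rewrite /chain_sum => H.
  have [q Hq] : exists q, \sum_s \prod_(i < n)
      B i (chain_vertex q s i) (chain_dir s i) != 0.
    apply/existsP; move: H; apply: contraR; rewrite negb_exists => /forallP H.
    by apply/eqP; apply: big1 => q _; have := H q; rewrite negbK => /eqP.
  have [s Hs] : exists s, \prod_(i < n)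
      B i (chain_vertex q s i) (chain_dir s i) != 0.
    apply/existsP; move: Hq; apply: contraR; rewrite negb_exists => /forallP Hq.
    by apply/eqP; apply: big1 => s _; have := Hq s; rewrite negbK => /eqP.
  exists q, s => i; move: Hs; apply: contra => Bi.
  by rewrite prodf_seq_eq0; apply/hasP; exists i; first exact: mem_index_enum.
have dirI i j : (i < n)%N -> (j < n)%N -> chain_dir s i = chain_dir s j -> i = j.
  by move=> i_n j_n /perm_inj /(congr1 val); rewrite /= !inordK.
(* A permutation uses each direction once, so a coordinate is incremented at most once along the
   chain. *)
have vE t (i : 'I_n) : (t <= n)%N ->
    chain_vertex q s t i = q i + (has (fun j => chain_dir s j == i) (iota 0 t))%:R.
  elim: t => [_|t IH tn].
    by rewrite /chain_vertex big_geq // ffunE /= ffunE.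
  rewrite chain_vertexS ffunE (IH (ltnW tn)) -addrA; congr (_ + _).
  have -> : iota 0 t.+1 = iota 0 t ++ [:: t] by rewrite -addn1 iotaD.
  rewrite has_cat [has _ [:: t]]/= orbF ffunE eq_sym.
  case: hasP => [[j]|_]; last by rewrite add0r.
  rewrite mem_iota add0n => /andP[_ jt] /eqP ji /=.
  case: eqP => [/esym it|_]; last by rewrite addr0.
  have jE : j = t by apply: dirI; rewrite ?ji ?it // (ltn_trans jt).
  by rewrite jE ltnn in jt.
have fresh (j : 'I_n) : chain_dir s j = j -> chain_vertex q s j j = q j.
  move=> dj; rewrite vE ?(ltnW (ltn_ord j))//.
  case: hasP => /= [[i]|_]; last by rewrite addr0.
  rewrite mem_iota add0n => /andP[_ ij] /eqP di.
  have iE : i = j by apply: dirI; rewrite ?di ?dj // (ltn_trans ij).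
  by rewrite iE ltnn in ij.
(* On a closing edge in direction [j] the label jumps back from true to false,
   which cancels [wrap_cochain j]. *)
have nowrap (j : 'I_n) : q j != ord_max.
  apply/eqP => qj; have /negP := Bq j; apply; apply/eqP.
  have vj t : (t <= n)%N -> chain_vertex q s t j = ord_max \/ chain_vertex q s t j = ord0.
    move=> tn; rewrite vE // qj; case: has; last by left; rewrite addr0.
    by right; apply: val_inj; rewrite /= (modn_small (_ : 1 < _)%N) // addn1 modnn.
  rewrite /B /wrap_cochain /coboundary /h inord_val -chain_vertexS.
  case: (eqVneq (chain_dir s j) j) => [dj|dj].
    rewrite dj eqxx /=.
    have vj0 : chain_vertex q s j j = ord_max by rewrite fresh.
    have vj1 : chain_vertex q s j.+1 j = ord0.
      rewrite chain_vertexS ffunE vj0 dj ffunE eqxx; apply: val_inj => /=.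
      by rewrite (modn_small (_ : 1 < _)%N) // addn1 modnn.
    by rewrite vj0 eqxx (lab1 _ _ vj0) (lab0 _ _ vj1) add0r addF2.
  have -> : (chain_dir s j == j :> nat) = false by apply/negbTE.
  rewrite add0r.
  have e : chain_vertex q s j.+1 j = chain_vertex q s j j.
    by rewrite chain_vertexS ffunE [basis_step _ _]ffunE eq_sym (negPf dj) addr0.
  case: (vj j (ltnW (ltn_ord j))) => ej.
    by rewrite (lab1 _ _ ej) lab1 ?addF2 // e.
  by rewrite (lab0 _ _ ej) lab0 ?addF2 // e.
have cell t i : (t <= n)%N -> (q i <= chain_vertex q s t i <= (q i).+1)%N.
  move=> tn; rewrite vE //; case: has; last by rewrite addr0 leqnn leqnSn.
  have qi : (q i < k.+1)%N by rewrite ltn_neqAle -ltnS ltn_ord andbT; exact: nowrap.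
  by rewrite /= (modn_small (_ : 1 < _)%N) // addn1 modn_small ?ltnS // leqnn leqnSn.
exists q => j; have := Bq j; rewrite /B /wrap_cochain /coboundary /h inord_val.
rewrite -chain_vertexS.
have -> : (((chain_dir s j : nat) == j) &&
    (chain_vertex q s j (chain_dir s j) == ord_max)) = false.
  apply/negbTE/negP => /andP[/eqP dj /eqP].
  by rewrite (val_inj dj) fresh ?(val_inj dj) // => qj; have := nowrap j; rewrite qj eqxx.
rewrite add0r.
case e1: (lab _ j); case e2: (lab _ j); rewrite ?addF2 ?eqxx // => _.
  exists (chain_vertex q s j), (chain_vertex q s j.+1).
  by split=> // i; apply: cell => //; exact: ltnW.
exists (chain_vertex q s j.+1), (chain_vertex q s j).
by split=> // i; apply: cell => //; exact: ltnW.
Qed.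

End TorusChains.

(** * Approximate solutions of the truncated system *)

Section FiniteSums.
Variables (R : realType) (I : eqType).
Implicit Types (r : seq I) (F G : I -> R).

Lemma ler_sum_mem r F G : (forall i, i \in r -> F i <= G i) ->
  \sum_(i <- r) F i <= \sum_(i <- r) G i.
Proof. by move=> FG; rewrite big_seq [leRHS]big_seq; apply: ler_sum. Qed.

Lemma sum_mem_ge0 r F : (forall i, i \in r -> 0 <= F i) ->
  0 <= \sum_(i <- r) F i.
Proof. by move=> F0; rewrite big_seq; apply: sumr_ge0. Qed.

Lemma sum_uniq_mem r1 r2 F : uniq r1 -> uniq r2 -> {subset r1 <= r2} ->
  \sum_(i <- r1) F i = \sum_(i <- r2 | i \in r1) F i.
Proof.
move=> u1 u2 s12; rewrite -[RHS]big_filter; apply: perm_big.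
apply: uniq_perm => //; first exact: filter_uniq.
by move=> i; rewrite mem_filter; case: (boolP (i \in r1)) => // /s12 ->.
Qed.

Lemma ler_sum_sub r1 r2 F : uniq r1 -> uniq r2 -> {subset r1 <= r2} ->
  (forall i, i \in r2 -> 0 <= F i) -> \sum_(i <- r1) F i <= \sum_(i <- r2) F i.
Proof.
move=> u1 u2 s12 F0; rewrite (sum_uniq_mem _ u1 u2 s12) big_mkcond /=.
by apply: ler_sum_mem => i i2; case: ifP => // _; exact: F0.
Qed.

Lemma sum_pred1_mem r a F : uniq r -> a \in r ->
  \sum_(i <- r) (a == i)%:R * F i = F a.
Proof.
move=> ur ar; rewrite (bigD1_seq a) //= eqxx mul1r big1 ?addr0 // => i ia.
by rewrite eq_sym (negPf ia) mul0r.
Qed.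

Lemma ler_term_sum r a F : a \in r -> (forall i, i \in r -> 0 <= F i) ->
  F a <= \sum_(i <- r) F i.
Proof.
move=> ar F0; rewrite (big_rem a) //= lerDl; apply: sum_mem_ge0 => i /mem_rem.
exact: F0.
Qed.

End FiniteSums.

(** On a grid of mesh at most [delta], the discrete statement yields a cell in which each component
    of [H] takes both signs weakly; the oscillation bound carries both signs, up to [e], to a common
    corner. *)
Lemma approximate_poincare_miranda (R : realType) (n : nat) (M : 'I_n -> R)
    (H : ('I_n -> R) -> 'I_n -> R) (delta e : R) :
  0 < delta -> (forall j, 0 <= M j) ->
  (forall x y : 'I_n -> R, (forall j, 0 <= x j <= M j) -> (forall j, 0 <= y j <= M j) ->
     (forall j, `|x j - y j| <= delta) -> forall j, `|H x j - H y j| <= e) ->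
  (forall (x : 'I_n -> R) j, (forall j, 0 <= x j <= M j) -> x j = 0 -> 0 <= H x j) ->
  (forall (x : 'I_n -> R) j, (forall j, 0 <= x j <= M j) -> x j = M j -> H x j <= 0) ->
  exists x : 'I_n -> R, (forall j, 0 <= x j <= M j) /\ forall j, `|H x j| <= e.
Proof.
case: n M H => [|n'] M H d0 M0 Hc H0 H1.
  by exists (fun=> 0); split; case.
(* The sum dominates every [M j], so one [k] makes the mesh at most [delta] in all directions. *)
pose k := Num.trunc ((\sum_j M j) / delta).
have Mk j : M j / k.+1%:R <= delta.
  rewrite ler_pdivrMr ?ltr0n // mulrC -ler_pdivrMr //.
  apply: ltW; apply: le_lt_trans (truncnS_gt _).
  rewrite ler_pM2r ?invr_gt0 //; apply: ler_term_sum => [|i _]; first exact: mem_index_enum.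
  exact: M0.
pose X (u : {ffun 'I_n'.+1 -> 'I_k.+2}) j := M j * ((u j)%:R / k.+1%:R).
have X_box u j : 0 <= X u j <= M j.
  rewrite /X mulr_ge0 ?divr_ge0 ?ler0n //= ler_piMr // ler_pdivrMr ?ltr0n //.
  by rewrite mul1r ler_nat -ltnS ltn_ord.
(* The sign conditions on the faces are not strict, so the label is prescribed there; [H0] and [H1]
   keep it compatible with the sign of [H]. *)
pose lab (u : {ffun 'I_n'.+1 -> 'I_k.+2}) j :=
  (u j != ord0) && ((u j == ord_max) || (H (X u) j <= 0)).
have labF u j : lab u j = false -> 0 <= H (X u) j.
  move=> /negbT; rewrite negb_and negbK negb_or => /orP[/eqP uj|/andP[_]].
    by apply: H0 => //; rewrite /X uj mul0r mulr0.
  by rewrite -ltNge => /ltW.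
have labT u j : lab u j = true -> H (X u) j <= 0.
  move=> /andP[_ /orP[/eqP uj|//]].
  by apply: H1 => //; rewrite /X uj divff ?mulr1 // pnatr_eq0.
have [|u j uj|q Hq] := @discrete_poincare_miranda n' k lab.
- by move=> u j uj; rewrite /lab uj eqxx.
- by rewrite /lab uj eqxx.
exists (X q); split=> // j.
have close (v : {ffun 'I_n'.+1 -> 'I_k.+2}) :
    (forall i, (q i <= v i <= (q i).+1)%N) -> `|H (X v) j - H (X q) j| <= e.
  move=> qv; apply: Hc => // i; rewrite /X -mulrBr normrM ger0_norm //.
  apply: le_trans (Mk i); apply: ler_wpM2l => //.
  rewrite -mulrBl normrM [X in _ * X]ger0_norm ?invr_ge0 ?ler0n //.
  rewrite ler_piMl ?invr_ge0 ?ler0n //.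
  have /andP[h1 h2] := qv i.
  by rewrite -natrB // ger0_norm ?ler0n // (ler_nat _ _ 1); lia.
have [v [w [lv lw qv qw]]] := Hq j.
have := close v qv; have := close w qw; have := labF _ _ lv; have := labT _ _ lw.
rewrite !ler_norml; lra.
Qed.

Lemma size1D d (a b : 'rV[nat]_d) : size1 (a + b) = (size1 a + size1 b)%N.
Proof. by rewrite /size1 -big_split; apply: eq_bigr => j _; rewrite mxE. Qed.

Section TruncatedSystem.
Variables (R : realType) (d : nat).
Local Notation P := 'rV[nat]_d.
Implicit Types (r : seq P) (K : P -> P -> R) (s n : P -> R).

(** Each ordered pair is charged half of the gain at [b + c] but only the loss of its first member;
    the reversed pair carries the other loss. *)
Definition coag_coef (a b c : P) : R :=
  2^-1 * (b + c == a)%:R - (b == a)%:R.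

(** The truncation restricts the reacting pairs: a cluster formed outside [r] leaves the system,
    while the loss of its two parents is kept. *)
Definition residual r K s n (a : P) : R :=
  s a + \sum_(b <- r) \sum_(c <- r) K b c * coag_coef a b c * (n b * n c).

(* On the box [0 <= n a <= Q ^+ size1 a] the gain at [a] is of order
   [Q ^+ size1 a] and the loss at [n a = Q ^+ size1 a] is at least of order
   [Q ^+ (2 * size1 a)], so the residual has the signs required on the faces
   once [Q] is large. *)
Lemma truncated_system r K s (e : R) : uniq r ->
  (forall a, a \in r -> (0 < size1 a)%N) ->
  (forall a b, a \in r -> b \in r -> 0 <= K a b) ->
  (forall a, a \in r -> 0 < K a a) ->
  (forall a, a \in r -> 0 <= s a) -> 0 < e ->
  exists n, [/\ forall a, 0 <= n a, forall a, a \notin r -> n a = 0 &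
    forall a, a \in r -> `|residual r K s n a| <= e].
Proof.
move=> ur size_gt0 K0 Kd s0 e0.
pose SK := \sum_(b <- r) \sum_(c <- r) K b c.
have SK0 : 0 <= SK by apply: sum_mem_ge0 => b br; apply: sum_mem_ge0 => c cr; exact: K0.
(* The summand at [a] alone ensures [s a + SK <= K a a * Q]. *)
pose Q := 1 + \sum_(a <- r) (s a + SK) / K a a.
have QK0 a : a \in r -> 0 <= (s a + SK) / K a a.
  by move=> ar; rewrite divr_ge0 ?addr_ge0 ?s0 // ltW ?Kd.
have Q1 : 1 <= Q by rewrite lerDl sum_mem_ge0.
have QK a : a \in r -> s a + SK <= K a a * Q.
  move=> ar; rewrite mulrC -ler_pdivrMr ?Kd //.
  by apply: le_trans (ler_term_sum ar QK0) _; rewrite lerDr.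
pose N := size r.
pose pt (i : 'I_N) := nth 0 r i.
have ptr i : pt i \in r by rewrite mem_nth.
pose M (i : 'I_N) := Q ^+ size1 (pt i).
have M0 i : 0 <= M i by rewrite exprn_ge0 // (le_trans _ Q1).
(* Extension by zero: outside [r] the sum is empty. *)
pose ext (x : 'I_N -> R) (a : P) := \sum_(i < N | pt i == a) x i.
have ext_pt x i : ext x (pt i) = x i.
  rewrite /ext (big_pred1 i) // => j; rewrite /pt nth_uniq //.
have ptP a : a \in r -> exists i, a = pt i.
  by move=> /(nthP 0)[i iN <-]; exists (Ordinal iN).
pose H x j := residual r K s (ext x) (pt j).
pose B := \sum_j M j.
have ext_ge0 x a : (forall j, 0 <= x j <= M j) -> 0 <= ext x a.
  by move=> xM; apply: sumr_ge0 => i _; have /andP[] := xM i.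
have ext_le x a : (forall j, 0 <= x j <= M j) -> a \in r ->
    ext x a <= Q ^+ size1 a.
  by move=> xM /ptP[i ->]; rewrite ext_pt; have /andP[] := xM i.
have ext_leB x a : (forall j, 0 <= x j <= M j) -> a \in r -> ext x a <= B.
  move=> xM /ptP[i ->]; rewrite ext_pt; have /andP[_ /le_trans] := xM i; apply.
  by apply: ler_term_sum => [|j _]; [exact: mem_index_enum|exact: M0].
have B0 : 0 <= B by apply: sumr_ge0.
(* On the box the products vary by at most [2 * (B * delta)] and the coefficients are at most 2, so
   the residual varies by at most [4 * SK * B * delta]. The added 1 keeps the denominator
   positive. *)
pose delta := e / (4 * SK * B + 1).
have D0 : 0 < 4 * SK * B + 1 by rewrite ltr_wpDl // !mulr_ge0.
have delta0 : 0 < delta by rewrite divr_gt0.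
have [|x y xM yM xy j|x j xM xj|x j xM xj|x [xM Hx]] :=
    @approximate_poincare_miranda R N M H delta e delta0.
- exact: M0.
- rewrite /H /residual opprD addrACA subrr add0r -sumrB.
  have -> : e = (4 * SK * B + 1) * delta by rewrite mulrC divfK // gt_eqF.
  apply: (@le_trans _ _ (4 * SK * B * delta)); last first.
    by rewrite ler_wpM2r ?lerDl // ltW.
  have -> : 4 * SK * B * delta = \sum_(b <- r) \sum_(c <- r) K b c * (4 * B * delta).
    rewrite -!mulrA mulrCA /SK big_distrl /=; apply: eq_bigr => b _.
    by rewrite big_distrl /=; apply: eq_bigr => c _; congr (_ * _); ring.
  apply: le_trans (ler_norm_sum _ _ _) _; apply: ler_sum_mem => b br.
  rewrite -sumrB; apply: le_trans (ler_norm_sum _ _ _) _; apply: ler_sum_mem => c cr.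
  rewrite -mulrBr -[X in `|X|]mulrA normrM [`|K b c|]ger0_norm ?K0 //.
  apply: ler_wpM2l; first exact: K0.
  rewrite normrM.
  have coef2 : `|coag_coef (pt j) b c| <= 2.
    by rewrite /coag_coef; case: eqP => _; case: eqP => _ /=; rewrite ler_norml; lra.
  have ext_close a : a \in r -> `|ext x a - ext y a| <= delta.
    by move=> /ptP[i ->]; rewrite !ext_pt.
  have prod_close : `|ext x b * ext x c - ext y b * ext y c| <= 2 * (B * delta).
    have -> : ext x b * ext x c - ext y b * ext y c =
      ext x b * (ext x c - ext y c) + (ext x b - ext y b) * ext y c by ring.
    apply: le_trans (ler_normD _ _) _; rewrite !normrM mulr2n mulrDl mul1r.
    apply: lerD.
      apply: ler_pM => //; last exact: ext_close.
      by rewrite ger0_norm ?ext_ge0 // ext_leB.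
    rewrite mulrC; apply: ler_pM => //; last exact: ext_close.
    by rewrite ger0_norm ?ext_ge0 // ext_leB.
  have -> : 4 * B * delta = 2 * (2 * (B * delta)) by ring.
  exact: ler_pM.
- rewrite /H /residual addr_ge0 ?s0 //.
  apply: sum_mem_ge0 => b br; apply: sum_mem_ge0 => c cr.
  (* Loss at [pt j] comes only from pairs with [b = pt j], and on this face the factor [ext x b]
     vanishes. *)
  have [->|bj] := eqVneq b (pt j); first by rewrite ext_pt xj mul0r mulr0.
  rewrite /coag_coef (negPf bj) subr0 !mulr_ge0 ?K0 ?ext_ge0 //.
- set l := size1 (pt j).
  pose f b c := K b c * (2^-1 * (b + c == pt j)%:R) * (ext x b * ext x c).
  pose g (b c : P) := (pt j == b)%:R * (K b c * (ext x b * ext x c)).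
  rewrite /H /residual.
  have -> : \sum_(b <- r) \sum_(c <- r)
        K b c * coag_coef (pt j) b c * (ext x b * ext x c) =
      \sum_(b <- r) \sum_(c <- r) f b c - \sum_(b <- r) \sum_(c <- r) g b c.
    rewrite -sumrB; apply: eq_bigr => b _; rewrite -sumrB; apply: eq_bigr => c _.
    by rewrite /f /g /coag_coef (eq_sym b (pt j)); ring.
  have gE : \sum_(b <- r) \sum_(c <- r) g b c =
      \sum_(c <- r) K (pt j) c * (ext x (pt j) * ext x c).
    under eq_bigr => b _ do rewrite /g -big_distrr /=.
    exact: (sum_pred1_mem (fun b => \sum_(c <- r) K b c * (ext x b * ext x c))).
  have gl : K (pt j) (pt j) * (Q ^+ l * Q ^+ l) <= \sum_(b <- r) \sum_(c <- r) g b c.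
    rewrite gE; apply: le_trans (ler_term_sum (ptr j) _); last first.
      by move=> c cr; rewrite !mulr_ge0 ?K0 ?ext_ge0.
    by rewrite ext_pt xj.
  (* Sizes add under coagulation, so the box heights are multiplicative: a pair merging into [pt j]
     has product at most [Q ^+ l]. *)
  have fl : \sum_(b <- r) \sum_(c <- r) f b c <= SK * Q ^+ l.
    rewrite big_distrl /=; apply: ler_sum_mem => b br.
    rewrite big_distrl /=; apply: ler_sum_mem => c cr.
    rewrite /f -mulrA; apply: ler_wpM2l; first exact: K0.
    case: eqP => [bc|_]; last by rewrite mulr0 mul0r exprn_ge0 // (le_trans _ Q1).
    rewrite mulr1 /l -bc size1D exprD; apply: le_trans (_ : ext x b * ext x c <= _).
      by rewrite ler_piMl ?mulr_ge0 ?ext_ge0 //; lra.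
    by apply: ler_pM; rewrite ?ext_ge0 ?ext_le.
  have Ql : Q <= Q ^+ l by rewrite ler_eXnr // size_gt0.
  have Ql0 : 0 <= Q ^+ l by rewrite exprn_ge0 // (le_trans _ Q1).
  have sl : s (pt j) <= s (pt j) * Q ^+ l.
    by rewrite ler_peMr ?s0 // exprn_ege1.
  have h1 : (s (pt j) + SK) * Q ^+ l <= K (pt j) (pt j) * (Q ^+ l * Q ^+ l).
    rewrite mulrA; apply: ler_wpM2r => //; apply: le_trans (QK _ (ptr j)) _.
    by apply: ler_wpM2l => //; rewrite ltW ?Kd.
  rewrite mulrDl in h1.
  lra.
exists (ext x); split=> [a|a|a /ptP[i ->]]; [exact: ext_ge0| |exact: Hx].
move=> ar; rewrite /ext big1 // => i /eqP ia.
by move: ar; rewrite -ia ptr.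
Qed.

End TruncatedSystem.

(** * Flux estimates *)

Section LatticeBall.
Variable d : nat.
Local Notation P := 'rV[nat]_d.

Lemma size1_eq0 (a : P) : (size1 a == 0)%N = (a == 0).
Proof.
rewrite /size1 sum_nat_eq0; apply/forallP/eqP => [a0|-> j]; last by rewrite mxE.
by apply/rowP => j; rewrite mxE; apply/eqP/a0.
Qed.

Lemma size1_gt0 (a : P) : (0 < size1 a)%N = (a != 0).
Proof. by rewrite lt0n size1_eq0. Qed.

Definition lattice_ball (L : nat) : seq P :=
  [seq a <- [seq \row_j (f j : nat) | f : {ffun 'I_d -> 'I_L.+1}] |
    (0 < size1 a <= L)%N].

Lemma mem_lattice_ball L (a : P) :
  (a \in lattice_ball L) = (0 < size1 a <= L)%N.
Proof.
rewrite mem_filter; case: (boolP (0 < size1 a <= L)%N) => //= /andP[_ aL].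
have aj j : (a 0%R j < L.+1)%N.
  by rewrite ltnS (leq_trans _ aL) // /size1 (bigD1 j) //= leq_addr.
apply/mapP; exists [ffun j => inord (a 0 j)]; first by rewrite mem_enum.
by apply/rowP => j; rewrite mxE ffunE inordK.
Qed.

Lemma uniq_lattice_ball L : uniq (lattice_ball L).
Proof.
rewrite filter_uniq // map_inj_uniq ?enum_uniq // => f g /rowP fg.
by apply/ffunP => j; apply: val_inj; have := fg j; rewrite !mxE.
Qed.

Lemma lattice_ballS L L' : (L <= L')%N ->
  {subset lattice_ball L <= lattice_ball L'}.
Proof.
move=> LL a; rewrite !mem_lattice_ball => /andP[-> aL] /=; exact: leq_trans LL.
Qed.

Lemma lattice_ball_Nstar L a : a \in lattice_ball L -> Nstar d a.
Proof. by rewrite mem_lattice_ball size1_gt0 => /andP[]. Qed.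

End LatticeBall.

Section WeakTruncated.
Variables (R : realType) (d : nat).
Local Notation P := 'rV[nat]_d.

(** Symmetry of [K] splits the loss evenly between the two partners. The function [g] has to vanish
    at sums leaving [r], because the truncation drops their gain. *)
Lemma weak_residual (r : seq P) (K : P -> P -> R) (s n g : P -> R) :
  uniq r -> (forall b c, b \in r -> c \in r -> K b c = K c b) ->
  (forall b c, b \in r -> c \in r -> b + c \notin r -> g (b + c) = 0) ->
  \sum_(a <- r) g a * residual r K s n a =
  \sum_(a <- r) g a * s a + 2^-1 * \sum_(b <- r) \sum_(c <- r)
     K b c * (g (b + c) - g b - g c) * (n b * n c).
Proof.
move=> ur Ks g0.
under eq_bigr => a _ do rewrite /residual mulrDr.
rewrite big_split /=; congr (_ + _).
under eq_bigr => a _ do rewrite big_distrr /=.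
rewrite exchange_big /=.
pose f b c := K b c * (n b * n c).
have E b : b \in r -> \sum_(a <- r) g a * (\sum_(c <- r)
     K b c * coag_coef R a b c * (n b * n c)) =
   \sum_(c <- r) f b c * (2^-1 * g (b + c) - g b).
  move=> br; under eq_bigr => a _ do rewrite big_distrr /=.
  rewrite exchange_big /= big_seq [RHS]big_seq; apply: eq_bigr => c cr.
  have -> : \sum_(a <- r) g a * (K b c * coag_coef R a b c * (n b * n c)) =
    f b c * (2^-1 * \sum_(a <- r) (b + c == a)%:R * g a -
             \sum_(a <- r) (b == a)%:R * g a).
    rewrite !big_distrr /= -sumrB big_distrr; apply: eq_bigr => a _ /=.
    by rewrite /f /coag_coef; ring.
  rewrite (sum_pred1_mem _ ur br); congr (_ * (_ * _ - _)).
  have [bcr|bcr] := boolP (b + c \in r); first exact: sum_pred1_mem.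
  rewrite g0 // big_seq big1 // => a ar.
  by case: eqP => [bca|_]; rewrite ?mul0r // bca ar in bcr *.
rewrite (eq_big_seq _ E).
have S : \sum_(b <- r) \sum_(c <- r) f b c * g c =
         \sum_(b <- r) \sum_(c <- r) f b c * g b.
  rewrite exchange_big /= big_seq [RHS]big_seq; apply: eq_bigr => b br.
  rewrite big_seq [RHS]big_seq; apply: eq_bigr => c cr.
  by rewrite /f (Ks c b) // (mulrC (n c)).
have -> : \sum_(b <- r) \sum_(c <- r) K b c * (g (b + c) - g b - g c) * (n b * n c)
  = \sum_(b <- r) \sum_(c <- r) f b c * g (b + c) -
    \sum_(b <- r) \sum_(c <- r) f b c * g b -
    \sum_(b <- r) \sum_(c <- r) f b c * g c.
  rewrite -!sumrB; apply: eq_bigr => b _; rewrite -!sumrB; apply: eq_bigr => c _.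
  by rewrite /f; ring.
have -> : \sum_(b <- r) \sum_(c <- r) f b c * (2^-1 * g (b + c) - g b) =
  2^-1 * \sum_(b <- r) \sum_(c <- r) f b c * g (b + c) -
    \sum_(b <- r) \sum_(c <- r) f b c * g b.
  rewrite !big_distrr /= -!sumrB; apply: eq_bigr => b _.
  rewrite !big_distrr /= -!sumrB; apply: eq_bigr => c _; ring.
rewrite S; lra.
Qed.

End WeakTruncated.

(** The map is increasing or decreasing according to the sign of [e]; the two-sided comparison of
    [x] and [z] covers both cases at the cost of the absolute value in the exponent of [t]. *)
Lemma powR_comparable (R : realType) (t x z e : R) : 0 < t -> 0 < x -> 0 < z ->
  x <= t * z -> z <= t * x -> x `^ e <= t `^ `|e| * z `^ e.
Proof.
move=> t0 x0 z0 xz zx; have t0' := ltW t0.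
have [e0|e0] := leP 0 e.
  rewrite ger0_norm // -powRM ?(ltW z0) //.
  by apply: ge0_ler_powR => //; rewrite nnegrE ?mulr_ge0 // ltW.
rewrite -[in z `^ _](opprK e) -[in x `^ _](opprK e) ltr0_norm //.
rewrite (powRN x) (powRN z) ler_pdivlMr ?powR_gt0 // mulrC ler_pdivrMr ?powR_gt0 //.
rewrite -powRM ?(ltW x0) //; apply: ge0_ler_powR.
- by rewrite oppr_ge0 ltW.
- by rewrite nnegrE ltW.
- by rewrite nnegrE mulr_ge0 // ltW.
- exact: zx.
Qed.

Lemma powRD_gt0 (R : realType) (x r t : R) : 0 < x ->
  x `^ (r + t) = x `^ r * x `^ t.
Proof. by move=> x0; apply: powRD; apply/implyP => _; rewrite gt_eqF. Qed.

Lemma powR_exprn (R : realType) (x t : R) (k : nat) : 0 <= x ->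
  (x ^+ k) `^ t = (x `^ t) ^+ k.
Proof.
move=> x0; elim: k => [|k IH]; first by rewrite !expr0 powR1.
by rewrite !exprS powRM ?exprn_ge0 // IH.
Qed.

(** * Power-law form of the kernel bound *)

Section KernelBound.
Variables (R : realType) (d : nat) (gamma p : R).
Local Notation P := 'rV[nat]_d.

(** Each of the two quotients inside [Phi] releases a power p of the total size, which raises its
    exponent from [gamma] to [gamma + 2 * p]. *)
Lemma kernel_boundE (a b : P) : Nstar d a -> Nstar d b ->
  kernel_bound gamma p a b =
  ((size1 a)%:R + (size1 b)%:R) `^ (gamma + 2 * p) *
  ((size1 a)%:R `^ (- p) * (size1 b)%:R `^ (- p)).
Proof.
rewrite /Nstar /= -!size1_gt0 => a0 b0.
have x0 : 0 < (size1 a)%:R :> R by rewrite ltr0n.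
have y0 : 0 < (size1 b)%:R :> R by rewrite ltr0n.
rewrite /kernel_bound /Phi.
set x := (size1 a)%:R in x0 *; set y := (size1 b)%:R in y0 *.
have xy0 : 0 < x + y by rewrite addr_gt0.
have -> : 1 - x / (x + y) = y / (x + y) by field; rewrite gt_eqF.
rewrite !powRM ?invr_ge0 ?(ltW x0) ?(ltW y0) ?(ltW xy0) //.
have -> : (x + y)^-1 `^ (- p) = (x + y) `^ p.
  by rewrite -powR_inv1 ?(ltW xy0) // -powRrM mulN1r opprK.
have -> : gamma + 2 * p = gamma + p + p by ring.
by rewrite !powRD_gt0 //; ring.
Qed.

(** Both sizes and their sum are within a factor 2 of [z], so each power in [kernel_boundE] may be
    replaced by one of [z]; the exponents add up to [gamma]. *)
Lemma kernel_bound_dyadic (z : R) (a b : P) : Nstar d a -> Nstar d b ->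
  (size1 a)%:R <= z -> z <= 2 * (size1 a)%:R ->
  (size1 b)%:R <= z -> z <= 2 * (size1 b)%:R ->
  z `^ gamma <= (2 `^ `|gamma + 2 * p| * 2 `^ `|p| * 2 `^ `|p|) * kernel_bound gamma p a b.
Proof.
move=> Na Nb; rewrite kernel_boundE //.
have := Na; have := Nb; rewrite /Nstar /= -!size1_gt0 => b0 a0.
have x0 : 0 < (size1 a)%:R :> R by rewrite ltr0n.
have y0 : 0 < (size1 b)%:R :> R by rewrite ltr0n.
set x := (size1 a)%:R in x0 *; set y := (size1 b)%:R in y0 *.
move=> xz zx yz zy.
have z0 : 0 < z by exact: lt_le_trans xz.
have -> : z `^ gamma = z `^ (gamma + 2 * p) * (z `^ (- p) * z `^ (- p)).
  by rewrite -!powRD_gt0 //; congr (_ `^ _); ring.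
have h1 : z `^ (gamma + 2 * p) <= 2 `^ `|gamma + 2 * p| * (x + y) `^ (gamma + 2 * p).
  by apply: powR_comparable => //; lra.
have h2 : z `^ (- p) <= 2 `^ `|p| * x `^ (- p).
  by rewrite -(normrN p); apply: powR_comparable => //; lra.
have h3 : z `^ (- p) <= 2 `^ `|p| * y `^ (- p).
  by rewrite -(normrN p); apply: powR_comparable => //; lra.
set u := (x + y) `^ _ in h1 *; set v := x `^ _ in h2 *; set w := y `^ _ in h3 *.
have -> : 2 `^ `|gamma + 2 * p| * 2 `^ `|p| * 2 `^ `|p| * (u * (v * w)) =
  2 `^ `|gamma + 2 * p| * u * (2 `^ `|p| * v * (2 `^ `|p| * w)) by ring.
by apply: ler_pM => //; rewrite ?mulr_ge0 ?powR_ge0 //; apply: ler_pM; rewrite ?powR_ge0.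
Qed.

End KernelBound.

Lemma sum_off_support (R : realType) (I : eqType) (r1 r2 : seq I) (F : I -> R) :
  uniq r1 -> uniq r2 -> (forall i, 0 <= F i) ->
  (forall i, i \notin r2 -> F i = 0) ->
  \sum_(i <- r1) F i <= \sum_(i <- r2) F i.
Proof.
move=> u1 u2 F0 Fr2.
rewrite (bigID (fun i => i \in r2)) /= [X in _ + X]big1 ?addr0; last first.
  by move=> i; exact: Fr2.
rewrite -big_filter; apply: ler_sum_sub => //; first exact: filter_uniq.
by move=> i; rewrite mem_filter => /andP[].
Qed.

(** * Moment bounds uniform in the truncation *)

Section UniformEstimates.
Variables (R : realType) (d : nat) (gamma p c1 : R).
Hypotheses (gamma_p : gamma + 2 * p < 1) (c1_gt0 : 0 < c1).
Local Notation P := 'rV[nat]_d.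
Local Notation ball := (@lattice_ball d).
Variables (K : P -> P -> R) (s : P -> R).
Hypothesis K_ge0 : forall a b, Nstar d a -> Nstar d b -> 0 <= K a b.
Hypothesis K_sym : forall a b, Nstar d a -> Nstar d b -> K a b = K b a.
Hypothesis K_lower : forall a b, Nstar d a -> Nstar d b ->
  c1 * kernel_bound gamma p a b <= K a b.
Variable J : R.
Hypothesis mass_source : forall L, \sum_(a <- ball L) (size1 a)%:R * s a <= J.

(** Sizes in (2^(k-1), 2^k], written with doubling so that k = 0 gives exactly the size 1. *)
Definition dyadic k (a : P) := (size1 a <= 2 ^ k < (size1 a).*2)%N.

Definition approximate_solution (L : nat) (e : R) (n : P -> R) :=
  [/\ forall a, 0 <= n a, forall a, a \notin ball L -> n a = 0 &
    forall a, a \in ball L -> `|residual (ball L) K s n a| <= e].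

(* Testing with [|a|] cut off at [2 ^ k] gives the flux of mass through
   [2 ^ k], bounded by the injected mass; a pair of clusters of the dyadic
   block [k] always crosses this size. *)
Lemma dyadic_flux L e n k : (2 ^ k <= L)%N ->
  e * \sum_(a <- ball L) (size1 a)%:R <= 1 -> approximate_solution L e n ->
  (2 ^ k)%:R `^ (gamma + 1) * (\sum_(a <- ball L | dyadic k a) n a) ^+ 2 <=
  2 * (J + 1) * (2 `^ `|gamma + 2 * p| * 2 `^ `|p| * 2 `^ `|p|) / c1.
Proof.
move=> kL eL [n0 nL nres]; set z := (2 ^ k)%N in kL *.
have NB a : a \in ball L -> Nstar d a by exact: lattice_ball_Nstar.
pose g (a : P) : R := if (size1 a <= z)%N then (size1 a)%:R else 0.
have g0 a : 0 <= g a by rewrite /g; case: ifP.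
have g_out b c : b \in ball L -> c \in ball L -> b + c \notin ball L -> g (b + c) = 0.
  rewrite !mem_lattice_ball /g size1D => /andP[b0 _] /andP[c0 _] bc.
  by rewrite ifF //; lia.
have := weak_residual s n (uniq_lattice_ball d L)
  (fun b c bL cL => K_sym (NB b bL) (NB c cL)) g_out.
(* The error [e] is so small that, weighted by sizes over the whole ball, it costs at most 1; this
   is the 1 in [J + 1]. *)
have low : - 1 <= \sum_(a <- ball L) g a * residual (ball L) K s n a.
  rewrite lerNl; apply: le_trans eL; rewrite -sumrN big_distrr /=.
  apply: ler_sum_mem => a aL; rewrite -mulrN.
  have e0 : 0 <= e by apply: le_trans (nres _ aL).
  apply: (@le_trans _ _ (g a * e)).
    by apply: ler_wpM2l => //; have := nres _ aL; rewrite ler_norml => /andP[]; lra.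
  rewrite mulrC; apply: ler_wpM2l => //; rewrite /g; case: ifP => // _.
have srcJ : \sum_(a <- ball L) g a * s a <= \sum_(a <- ball z) (size1 a)%:R * s a.
  rewrite (sum_uniq_mem _ (uniq_lattice_ball d z) (uniq_lattice_ball d L)); last first.
    exact: lattice_ballS.
  rewrite [leRHS]big_mkcond /=; apply: ler_sum_mem => a.
  rewrite !mem_lattice_ball /g => /andP[-> _] /=.
  by case: ifP; rewrite ?mul0r.
move=> E; rewrite E in low.
pose D : R := 2 `^ `|gamma + 2 * p| * 2 `^ `|p| * 2 `^ `|p|.
have T0 : 0 < D by rewrite !mulr_gt0 // powR_gt0.
pose C := c1 / D.
(* Every term is non-positive because [g] is subadditive. Two clusters of block k have total size
   above [z], so [g (b + c)] is 0 and the bracket is at most [- z]. *)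
have gain : \sum_(b <- ball L) \sum_(c <- ball L)
      K b c * (g (b + c) - g b - g c) * (n b * n c) <=
    - (C * (z%:R `^ (gamma + 1) * (\sum_(a <- ball L | dyadic k a) n a) ^+ 2)).
  have -> : \sum_(a <- ball L | dyadic k a) n a =
      \sum_(a <- ball L) (if dyadic k a then n a else 0) by exact: big_mkcond.
  rewrite expr2 big_distrl /= -mulNr !big_distrr /=.
  apply: ler_sum_mem => b bL; rewrite !big_distrr /=.
  apply: ler_sum_mem => c cL.
  have K0 := K_ge0 (NB _ bL) (NB _ cL).
  have neg : g (b + c) - g b - g c <= 0.
    rewrite /g size1D; case: ifP => bc.
      by rewrite !ifT ?natrD; first lra; lia.
    by case: ifP; case: ifP => _ _; rewrite ?oppr0 ?addr0 ?sub0r ?oppr_le0 ?ler0n //; lra.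
  have triv : K b c * (g (b + c) - g b - g c) * (n b * n c) <= 0.
    by rewrite mulr_le0_ge0 ?mulr_ge0_le0 // mulr_ge0.
  have [/andP[bz zb]|_] := boolP (dyadic k b); last by rewrite mul0r !mulr0.
  have [/andP[cz zc]|_] := boolP (dyadic k c); last by rewrite !mulr0.
  have gz : g (b + c) - g b - g c <= - z%:R.
    rewrite /g size1D bz cz ifF; last by rewrite -/z in zb zc; lia.
    by rewrite sub0r -opprD lerN2 -natrD ler_nat; rewrite -/z in zb zc; lia.
  have Kz : C * z%:R `^ gamma <= K b c.
    apply: le_trans (K_lower (NB _ bL) (NB _ cL)); rewrite /C -mulrA.
    apply: ler_wpM2l; first exact: ltW.
    rewrite mulrC ler_pdivrMr // mulrC; apply: kernel_bound_dyadic; rewrite -?natrM ?ler_nat.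
    - exact: NB.
    - exact: NB.
    - exact: bz.
    - by rewrite mul2n ltnW.
    - exact: cz.
    - by rewrite mul2n ltnW.
  have z0 : 0 < z%:R :> R by rewrite ltr0n expn_gt0.
  rewrite powRD_gt0 // powRr1 ?(ltW z0) //.
  have -> : - C * (z%:R `^ gamma * z%:R * (n b * n c)) =
    - (C * z%:R `^ gamma * z%:R) * (n b * n c) by ring.
  apply: ler_wpM2r; first by rewrite mulr_ge0.
  apply: (@le_trans _ _ (K b c * - z%:R)); first exact: ler_wpM2l.
  by rewrite mulrN lerN2; apply: ler_wpM2r => //; exact: ltW.
rewrite ler_pdivlMr // -/D.
have := mass_source z; move: gain low srcJ.
set X := z%:R `^ _ * _; set Y := \sum_(b <- _) _.
set S := \sum_(a <- _) _; set S' := \sum_(a <- _) _.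
move=> gain low srcJ mJ.
have : C * X <= 2 * (J + 1) by lra.
by rewrite /C mulrAC ler_pdivrMr // mulrC.
Qed.

(** The exponent is the moment order [gamma + p] minus [(gamma + 1) / 2], the decay exponent of the
    number of clusters in a dyadic block. *)
Definition decay_rate : R := 2 `^ ((gamma + 2 * p - 1) / 2).

Lemma decay_rate_gt0 : 0 < decay_rate. Proof. exact: powR_gt0. Qed.

Lemma decay_rate_lt1 : decay_rate < 1.
Proof.
rewrite /decay_rate -[ltRHS](powRr0 2) /powR pnatr_eq0 /= ltr_expR.
rewrite mul0r pmulr_llt0; last by rewrite ln_gt0 // ltr1n.
by rewrite pmulr_llt0 ?invr_gt0 // subr_lt0.
Qed.

Definition moment_weight (a : P) : R := (size1 a)%:R `^ (gamma + p).

Lemma moment_weight_ge0 a : 0 <= moment_weight a. Proof. exact: powR_ge0. Qed.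

(** On block k the weight is comparable with the power [gamma + p] of 2^k. As the flux estimate
    controls the square of the number of clusters, the bound is compared after squaring. *)
Lemma dyadic_moment : exists C : R, 0 <= C /\ forall L (e : R) n k, (2 ^ k <= L)%N ->
  e * \sum_(a <- ball L) (size1 a)%:R <= 1 -> approximate_solution L e n ->
  \sum_(a <- ball L | dyadic k a) moment_weight a * n a <= C * decay_rate ^+ k.
Proof.
pose A := 2 * (J + 1) * (2 `^ `|gamma + 2 * p| * 2 `^ `|p| * 2 `^ `|p|) / c1.
pose T : R := 2 `^ `|gamma + p|.
have T0 : 0 <= T by exact: powR_ge0.
(* The factor 1 + |A| replaces a square root of [A]: its square is at least [A]. *)
exists (T * (1 + `|A|)); split; first by rewrite mulr_ge0 // addr_ge0.
move=> L e n k kL eL nsol; have := dyadic_flux kL eL nsol; rewrite -/A.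
have [n0 _ _] := nsol.
set z := (2 ^ k)%:R; set D := \sum_(a <- _ | _) n a => flux.
have z0 : 0 < z :> R by rewrite ltr0n expn_gt0.
have D0 : 0 <= D by apply: sumr_ge0.
have zE x : z `^ x = (2 `^ x) ^+ k.
  by rewrite /z natrX powR_exprn.
set W := \sum_(a <- _ | _) _.
have WD : W <= T * z `^ (gamma + p) * D.
  rewrite /W /D big_distrr /=; apply: ler_sum => a /andP[az za].
  apply: ler_wpM2r => //; apply: powR_comparable => //.
  - by rewrite ltr0n; move: za; rewrite -/z; lia.
  - by rewrite -natrM ler_nat mul2n -addnn (leq_trans az) ?leq_addr.
  - by rewrite -natrM ler_nat mul2n ltnW.
have W0 : 0 <= W by apply: sumr_ge0 => a _; rewrite mulr_ge0 // moment_weight_ge0.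
have rho0 := ltW decay_rate_gt0.
rewrite -ler_sqr ?nnegrE //; last first.
  by rewrite !mulr_ge0 ?exprn_ge0 ?addr_ge0.
apply: le_trans (_ : (T * z `^ (gamma + p) * D) ^+ 2 <= _).
  by rewrite ler_sqr ?nnegrE // !mulr_ge0 ?powR_ge0.
have -> : (T * z `^ (gamma + p) * D) ^+ 2 =
    T ^+ 2 * (decay_rate ^+ k) ^+ 2 * (z `^ (gamma + 1) * D ^+ 2).
  have -> : (decay_rate ^+ k) ^+ 2 = z `^ (gamma + 2 * p - 1).
    rewrite zE -exprM mulnC exprM; congr (_ ^+ _).
    by rewrite expr2 /decay_rate -powRD_gt0 //; congr (_ `^ _); field.
  have -> : T ^+ 2 * z `^ (gamma + 2 * p - 1) * (z `^ (gamma + 1) * D ^+ 2) =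
     T ^+ 2 * (z `^ (gamma + 2 * p - 1) * z `^ (gamma + 1)) * D ^+ 2 by ring.
  rewrite -powRD_gt0 //.
  have -> : gamma + 2 * p - 1 + (gamma + 1) = (gamma + p) + (gamma + p) by ring.
  by rewrite (powRD_gt0 (gamma + p) (gamma + p) z0); ring.
have -> : (T * (1 + `|A|) * decay_rate ^+ k) ^+ 2 =
  T ^+ 2 * (decay_rate ^+ k) ^+ 2 * (1 + `|A|) ^+ 2 by ring.
apply: ler_wpM2l; first by rewrite mulr_ge0 ?exprn_ge0.
apply: le_trans flux _; have := ler_norm A; have := normr_ge0 A; nra.
Qed.

(** The dyadic bounds are summed as a geometric series, by descending induction on M from M = N,
    where the tail is empty. *)
Lemma uniform_tail : exists C : R, 0 <= C /\ forall N (e : R) n,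
  e * \sum_(a <- ball (2 ^ N)) (size1 a)%:R <= 1 ->
  approximate_solution (2 ^ N) e n ->
  \sum_(a <- ball (2 ^ N)) moment_weight a * n a <= C /\
  forall M, \sum_(a <- ball (2 ^ N) | (2 ^ M < size1 a)%N)
     moment_weight a * n a <= C * decay_rate ^+ M.
Proof.
have [C [C0 block]] := dyadic_moment.
have r0 := decay_rate_gt0; have r1 := decay_rate_lt1.
set rho := decay_rate in block r0 r1 *.
have r1' : 0 < 1 - rho by rewrite subr_gt0.
pose C' := C / (1 - rho).
have C'0 : 0 <= C' by rewrite divr_ge0 // ltW.
have CE : C = C' * (1 - rho) by rewrite /C' divfK // gt_eqF.
(* [C] pays for the block of size 1 and [C'] for all larger sizes. *)
exists (C + C'); split=> [|N e n eN nsol]; first exact: addr_ge0.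
have [n0 nN _] := nsol.
have w0 a : 0 <= moment_weight a * n a by rewrite mulr_ge0 // moment_weight_ge0.
have tailS M : \sum_(a <- ball (2 ^ N) | (2 ^ M < size1 a)%N) moment_weight a * n a =
  \sum_(a <- ball (2 ^ N) | dyadic M.+1 a) moment_weight a * n a +
  \sum_(a <- ball (2 ^ N) | (2 ^ M.+1 < size1 a)%N) moment_weight a * n a.
  rewrite (bigID (fun a => size1 a <= 2 ^ M.+1)%N) /=; congr (_ + _); apply: eq_bigl => a.
    by rewrite /dyadic andbC; congr (_ && _); rewrite expnS; lia.
  by rewrite -ltnNge andb_idl // => /(leq_trans _); apply; rewrite ltnS leq_exp2l.
have tail0 M : (N <= M)%N ->
    \sum_(a <- ball (2 ^ N) | (2 ^ M < size1 a)%N) moment_weight a * n a = 0.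
  move=> NM; rewrite big_seq_cond big1 // => a.
  rewrite mem_lattice_ball => /andP[/andP[_ aN]].
  by rewrite ltnNge (leq_trans aN) // leq_exp2l.
have rM0 M : 0 <= C' * rho ^+ M by rewrite mulr_ge0 ?exprn_ge0 // ltW.
have tail m M : (M + m = N)%N ->
    \sum_(a <- ball (2 ^ N) | (2 ^ M < size1 a)%N) moment_weight a * n a <= C' * rho ^+ M.
  elim: m M => [|m IH] M MN.
    by rewrite addn0 in MN; rewrite tail0 ?rM0 // MN.
  rewrite tailS; have := IH M.+1; rewrite addSnnS => /(_ MN) tl.
  have kN : (2 ^ M.+1 <= 2 ^ N)%N by rewrite leq_exp2l // -MN; lia.
  have bl := block _ _ _ _ kN eN nsol.
  apply: le_trans (lerD bl tl) _.
  rewrite CE -mulrA -mulrDr; apply: ler_wpM2l => //.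
  (* What remains is [(2 - rho) * rho <= 1], that is, non-negativity of the square of [1 - rho]. *)
  rewrite exprS -{2}(mul1r (rho * _)) -mulrDl mulrA; apply: ler_piMl.
    by rewrite exprn_ge0 // ltW.
  nra.
have tail' M : \sum_(a <- ball (2 ^ N) | (2 ^ M < size1 a)%N)
    moment_weight a * n a <= C' * rho ^+ M.
  have [NM|/ltnW MN] := leqP N M; last by apply: (tail (N - M)%N); rewrite subnKC.
  by rewrite tail0.
split=> [|M]; last first.
  by apply: le_trans (tail' M) _; rewrite ler_wpM2r ?exprn_ge0 ?lerDr // ltW.
rewrite (bigID (fun a => dyadic 0 a)) /=; apply: lerD.
  by have := block _ _ _ 0%N _ eN nsol; rewrite expr0 mulr1; apply; rewrite expn0 expn_gt0.
have := tail' 0%N; rewrite expr0 mulr1; apply: le_trans.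
rewrite big_seq_cond [leRHS]big_seq_cond big_mkcond [leRHS]big_mkcond /=.
apply: ler_sum => a _; case: ifP => [/andP[aB nd]|_]; last by case: ifP.
rewrite aB ifT //; move: aB nd; rewrite mem_lattice_ball /dyadic expn0; lia.
Qed.

End UniformEstimates.

(** * Passage to the limit *)

Section RealSums.
Variables (R : realType) (T : choiceType).
Implicit Types (D : set T) (f h : T -> R) (r : seq T).

Lemma esum_le_seq D h (E : R) :
  (forall r, uniq r -> (forall x, x \in r -> D x) ->
     \sum_(x <- r) h x <= E) ->
  (\esum_(x in D) (h x)%:E <= E%:E)%E.
Proof.
move=> hE; apply: ge_ereal_sup => _ [A [/finite_seqP[r ->] AD] <-].
have -> : [set` r] = [set` undup r].
  by apply/seteqP; split=> x /=; rewrite mem_undup.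
rewrite -fsbig_seq ?undup_uniq // sumEFin lee_fin hE ?undup_uniq // => x.
by rewrite mem_undup => /AD.
Qed.

Lemma esum_seq_setD D h r : uniq r -> (forall x, x \in r -> D x) ->
  (forall x, 0 <= h x) ->
  \esum_(x in D) (h x)%:E =
  ((\sum_(x <- r) h x)%:E + \esum_(x in D `&` ~` [set` r]) (h x)%:E)%E.
Proof.
move=> ur rD h0; rewrite (esumID [set` r]) => [|x _]; last by rewrite lee_fin.
congr (_ + _)%E; have -> : D `&` [set` r] = [set` r].
  by apply/seteqP; split=> [x []//|x /= xr]; split=> //; exact: rD.
rewrite esum_fset => [||x _]; [|exact: finite_seq|by rewrite lee_fin].
by rewrite -fsbig_seq // sumEFin.
Qed.

(** The positive and the negative part each exceed their sum over [r] by a remainder between 0 and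
    [E], and the difference of the two remainders is at most [E] in absolute value. *)
Lemma rsum_approx D f r (E : R) : uniq r -> (forall x, x \in r -> D x) ->
  (forall r', uniq r' -> (forall x, x \in r' -> D x /\ x \notin r) ->
     \sum_(x <- r') `|f x| <= E) ->
  summable D (EFin \o f) /\ `|rsum D f - \sum_(x <- r) f x| <= E.
Proof.
move=> ur rD fE.
have tail h : (forall x, 0 <= h x <= `|f x|) ->
    exists2 t, 0 <= t <= E &
      \esum_(x in D) (h x)%:E = (\sum_(x <- r) h x + t)%:E.
  move=> hf; have h0 x : 0 <= h x by have /andP[] := hf x.
  rewrite (esum_seq_setD ur rD) //; set t := esum _ _.
  have tE : (t <= E%:E)%E.
    apply: esum_le_seq => r' ur' r'D.
    apply: le_trans (fE r' ur' _); last first.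
      by move=> x /r'D[Dx xr]; split=> //; apply/negP.
    by apply: ler_sum => x _; have /andP[] := hf x.
  have t0 : (0 <= t)%E by apply: esum_ge0 => x _; rewrite lee_fin.
  have tf : t \is a fin_num.
    by rewrite ge0_fin_numE // (le_lt_trans tE) // ltry.
  exists (fine t); first by rewrite -!lee_fin fineK // t0.
  by rewrite EFinD fineK.
have [t1 /andP[t10 t1E] e1] : exists2 t, 0 <= t <= E &
    \esum_(x in D) (Num.max (f x) 0)%:E = (\sum_(x <- r) Num.max (f x) 0 + t)%:E.
  by apply: tail => x; rewrite le_max lexx orbT ge_max ler_norm normr_ge0.
have [t2 /andP[t20 t2E] e2] : exists2 t, 0 <= t <= E &
    \esum_(x in D) (Num.max (- f x) 0)%:E = (\sum_(x <- r) Num.max (- f x) 0 + t)%:E.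
  apply: tail => x; rewrite le_max lexx orbT ge_max normr_ge0 andbT.
  by rewrite -normrN ler_norm.
have [t3 _ e3] : exists2 t, 0 <= t <= E &
    \esum_(x in D) `|f x|%:E = (\sum_(x <- r) `|f x| + t)%:E.
  by apply: tail => x; rewrite normr_ge0 lexx.
split.
  rewrite /summable (_ : (fun x => _) = (fun x => `|f x|%:E)) ?e3 ?ltry //.
rewrite /rsum.
have -> : ((EFin \o f)^\+)%E = (fun x => (Num.max (f x) 0)%:E).
  by apply/funext => x; rewrite funeposE /= EFin_max.
have -> : ((EFin \o f)^\-)%E = (fun x => (Num.max (- f x) 0)%:E).
  by apply/funext => x; rewrite funenegE /= EFin_max.
rewrite e1 e2 -EFinB /=.
have -> : \sum_(x <- r) f x =
    \sum_(x <- r) Num.max (f x) 0 - \sum_(x <- r) Num.max (- f x) 0.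
  rewrite -sumrB; apply: eq_bigr => x _.
  by case: (leP (f x) 0) => fx; case: (leP (- f x) 0) => fx'; lra.
by rewrite ler_norml; lra.
Qed.

End RealSums.

Section Limits.
Variables (R : realType) (I : Type) (F : set_system I).
Hypothesis FF : ProperFilter F.

Lemma cvg_finite_sum (J : Type) (r : seq J) (f : J -> I -> R) (l : J -> R) :
  (forall j, f j x @[x --> F] --> l j) ->
  \sum_(j <- r) f j x @[x --> F] --> \sum_(j <- r) l j.
Proof. by move=> fl; apply: cvg_big => //; exact: add_continuous. Qed.

End Limits.

Lemma ultra_pushforward (I J : Type) (F : set_system I) (u : I -> J) :
  UltraFilter F -> UltraFilter (u @ F).
Proof.
move=> FU; split; first exact: fmap_proper_filter.
move=> G GF FG; apply/seteqP; split=> [A GA|A]; last exact: FG.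
have [//|FA] := in_ultra_setVsetC (u @^-1` A) FU.
have [x [Ax nAx]] : A `&` ~` A !=set0.
  by apply: (@filter_ex _ G); apply: filterI => //; apply: FG.
by [].
Qed.

(** The image ultrafilter lives on a compact interval, hence converges. One ultrafilter thus serves
    all coordinates at once, without diagonal extraction. *)
Lemma ultrafilter_bounded_cvg (R : realType) (I : Type) (F : set_system I)
    (u : I -> R) (B : R) : UltraFilter F -> (forall i, 0 <= u i <= B) ->
  exists l : R, u i @[i --> F] --> l.
Proof.
move=> FU uB; have := @segment_compact R 0 B; rewrite compact_ultra => /(_ (u @ F)).
case=> [||l [_ ul]]; last by exists l.
- exact: ultra_pushforward.
- apply: (@filterS _ F _ setT) => [i _|]; last exact: filterT.
  by rewrite /= in_itv /= uB.
Qed.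

Lemma invn_eventually (R : realType) (c e : R) : 0 < e ->
  exists N, forall M, (N <= M)%N -> c / M.+1%:R <= e.
Proof.
move=> e0; exists (Num.trunc (c / e)) => M NM.
rewrite ler_pdivrMr ?ltr0n // mulrC -ler_pdivrMr //.
apply: le_trans (ltW (truncnS_gt _)) _; by rewrite ler_nat ltnS.
Qed.

(** * Tails of the double series *)

Section PairTerms.
Variables (R : realType) (d : nat) (gamma p c2 : R).
Local Notation P := 'rV[nat]_d.
Local Notation ball := (@lattice_ball d).
Local Notation weight := (@moment_weight R d gamma p).
Variable K : P -> P -> R.
Hypothesis c2_ge0 : 0 <= c2.
Hypothesis K_ge0 : forall a b, Nstar d a -> Nstar d b -> 0 <= K a b.
Hypothesis K_sym : forall a b, Nstar d a -> Nstar d b -> K a b = K b a.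
Hypothesis K_upper : forall a b, Nstar d a -> Nstar d b ->
  K a b <= c2 * kernel_bound gamma p a b.

(** With one size at most [Y], the total size is comparable with the other size up to the factor 1 +
    Y, and powers of the small size are comparable with 1. The kernel then factorises into two
    weights of order [gamma + p]. *)
Lemma kernel_bound_near (Y : nat) (b c : P) : Nstar d b -> Nstar d c ->
  (size1 c <= Y)%N ->
  kernel_bound gamma p b c <=
  (1 + Y%:R) `^ `|gamma + 2 * p| * Y%:R `^ `|gamma + 2 * p| * (weight b * weight c).
Proof.
move=> Nb Nc; rewrite kernel_boundE // /moment_weight.
have := Nb; have := Nc; rewrite /Nstar /= -!size1_gt0 => c0 b0.
rewrite -(ler_nat R).
have x1 : 1 <= (size1 b)%:R :> R by rewrite ler1n.
have y1 : 1 <= (size1 c)%:R :> R by rewrite ler1n.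
set x := (size1 b)%:R in x1 *; set y := (size1 c)%:R in y1 *; set Z := Y%:R.
move=> yY; have x0 : 0 < x by exact: lt_le_trans x1.
have y0 : 0 < y by exact: lt_le_trans y1.
set e := gamma + 2 * p.
have h1 : (x + y) `^ e <= (1 + Z) `^ `|e| * x `^ e.
  by apply: powR_comparable; nra.
have h2 : 1 <= Z `^ `|e| * y `^ e.
  have e1 : 1 `^ e = 1 :> R by rewrite powR1.
  by rewrite -[leLHS]e1; apply: powR_comparable; nra.
have wE (t : R) : 0 < t -> t `^ (gamma + p) = t `^ e * t `^ (- p).
  by move=> t0; rewrite -powRD_gt0 // /e; congr (_ `^ _); ring.
rewrite !wE //.
have -> : (1 + Z) `^ `|e| * Z `^ `|e| * (x `^ e * x `^ (- p) * (y `^ e * y `^ (- p)))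
  = ((1 + Z) `^ `|e| * x `^ e) * (Z `^ `|e| * y `^ e) * (x `^ (- p) * y `^ (- p))
  by ring.
apply: ler_wpM2r; first by rewrite mulr_ge0 ?powR_ge0.
rewrite -[leLHS]mulr1; apply: ler_pM => //; exact: powR_ge0.
Qed.

Definition pair_term (g m : P -> R) (b c : P) : R :=
  K b c * (g (b + c) - g b - g c) * (m b * m c).

Lemma pair_termC g m b c : Nstar d b -> Nstar d c ->
  pair_term g m b c = pair_term g m c b.
Proof.
move=> Nb Nc; rewrite /pair_term K_sym // (addrC b) (mulrC (m b)).
by congr (_ * _ * _); rewrite addrAC.
Qed.

Variables (g : P -> R) (Y : nat).
Hypothesis g_supp : forall a, (Y < size1 a)%N -> g a = 0.

Lemma pair_term_tail : exists2 B, 0 <= B & forall (m : P -> R) M L,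
  (forall a, 0 <= m a) -> (Y <= 2 ^ M)%N ->
  \sum_(b <- ball L) \sum_(c <- ball L)
    (if (size1 b <= 2 ^ M)%N && (size1 c <= 2 ^ M)%N then 0
     else `|pair_term g m b c|) <=
  B * ((\sum_(a <- ball L | (2 ^ M < size1 a)%N) weight a * m a) *
       \sum_(a <- ball L) weight a * m a).
Proof.
pose A := (1 + Y%:R) `^ `|gamma + 2 * p| * Y%:R `^ `|gamma + 2 * p| : R.
pose G := \sum_(a <- ball Y) `|g a|.
have A0 : 0 <= A by rewrite mulr_ge0 ?powR_ge0.
have G0 : 0 <= G by apply: sumr_ge0.
pose B := c2 * A * G; have B0 : 0 <= B by rewrite !mulr_ge0.
exists (2 * B) => [|m M L m0 YM]; first by rewrite mulr_ge0.
have wm0 a : 0 <= weight a * m a by rewrite mulr_ge0 ?moment_weight_ge0.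
have far b c : Nstar d b -> Nstar d c -> (2 ^ M < size1 b)%N ->
    `|pair_term g m b c| <= B * (weight b * m b * (weight c * m c)).
  move=> Nb Nc bM; have bY : (Y < size1 b)%N := leq_ltn_trans YM bM.
  rewrite /pair_term (g_supp bY) g_supp ?subr0 ?sub0r; last first.
    by rewrite size1D ltn_addr.
  have [cY|cY] := leqP (size1 c) Y; last first.
    by rewrite g_supp // oppr0 mulr0 mul0r normr0 !mulr_ge0 ?moment_weight_ge0.
  rewrite !normrM normrN (ger0_norm (K_ge0 Nb Nc)) !(ger0_norm (m0 _)).
  have gG : `|g c| <= G.
    apply: (@ler_term_sum _ _ (ball Y) c (fun a => `|g a|)) => //.
    by rewrite mem_lattice_ball cY size1_gt0 Nc.
  have KA : K b c <= c2 * A * (weight b * weight c).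
    apply: le_trans (K_upper Nb Nc) _; rewrite -mulrA; apply: ler_wpM2l => //.
    exact: kernel_bound_near.
  have -> : B * (weight b * m b * (weight c * m c)) =
    c2 * A * (weight b * weight c) * G * (m b * m c) by rewrite /B; ring.
  apply: ler_wpM2r; first by rewrite mulr_ge0.
  by apply: ler_pM => //; exact: K_ge0.
pose t a := if (2 ^ M < size1 a)%N then weight a * m a else 0.
have t0 a : 0 <= t a by rewrite /t; case: ifP.
have -> : \sum_(a <- ball L | (2 ^ M < size1 a)%N) weight a * m a =
  \sum_(a <- ball L) t a by exact: big_mkcond.
have bound b c : b \in ball L -> c \in ball L ->
    (if (size1 b <= 2 ^ M)%N && (size1 c <= 2 ^ M)%N then 0
     else `|pair_term g m b c|) <=
    B * (t b * (weight c * m c)) + B * (weight b * m b * t c).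
  move=> /lattice_ball_Nstar Nb /lattice_ball_Nstar Nc.
  have [bM|bM] := leqP (size1 b) (2 ^ M) => /=; last first.
    have tb : t b = weight b * m b by rewrite /t bM.
    by rewrite tb; apply: le_trans (far _ _ Nb Nc bM) _; rewrite lerDl mulr_ge0 // mulr_ge0.
  have [cM|cM] := leqP (size1 c) (2 ^ M).
    by rewrite addr_ge0 // mulr_ge0 // mulr_ge0.
  have tc : t c = weight c * m c by rewrite /t cM.
  rewrite tc pair_termC //; apply: le_trans (far _ _ Nc Nb cM) _.
  by rewrite [_ * (weight b * m b)]mulrC lerDr mulr_ge0 // mulr_ge0.
apply: le_trans (_ : \sum_(b <- ball L) \sum_(c <- ball L)
   (B * (t b * (weight c * m c)) + B * (weight b * m b * t c)) <= _).
  by apply: ler_sum_mem => b bL; apply: ler_sum_mem => c cL; exact: bound.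
have prodE (u v : P -> R) : \sum_(b <- ball L) \sum_(c <- ball L) B * (u b * v c) =
    B * ((\sum_(b <- ball L) u b) * \sum_(c <- ball L) v c).
  rewrite big_distrl big_distrr /=; apply: eq_bigr => b _.
  by rewrite big_distrr big_distrr.
under eq_bigr => b _ do rewrite big_split /=.
rewrite big_split /= !prodE.
by set S := \sum_(a <- _) t a; set W := \sum_(a <- _) _; nra.
Qed.

End PairTerms.

(** * The limit of the approximate solutions *)

Section Existence.
Variables (R : realType) (d : nat) (gamma p c1 c2 : R).
Hypotheses (gamma_p : gamma + 2 * p < 1) (c1_gt0 : 0 < c1) (c2_ge0 : 0 <= c2).
Local Notation P := 'rV[nat]_d.
Local Notation ball := (@lattice_ball d).
Local Notation weight := (@moment_weight R d gamma p).
Local Notation rho := (decay_rate gamma p).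
Variables (K : P -> P -> R) (s : P -> R).
Hypothesis K_ge0 : forall a b, Nstar d a -> Nstar d b -> 0 <= K a b.
Hypothesis K_sym : forall a b, Nstar d a -> Nstar d b -> K a b = K b a.
Hypothesis K_lower : forall a b, Nstar d a -> Nstar d b ->
  c1 * kernel_bound gamma p a b <= K a b.
Hypothesis K_upper : forall a b, Nstar d a -> Nstar d b ->
  K a b <= c2 * kernel_bound gamma p a b.
Hypothesis s_ge0 : forall a, Nstar d a -> 0 <= s a.
Variable J : R.
Hypothesis mass_source : forall L, \sum_(a <- ball L) (size1 a)%:R * s a <= J.

(** Only finite sums are bounded, so the bounds pass to pointwise limits. *)
Definition moment_bounds (C : R) (m : P -> R) :=
  [/\ forall a, 0 <= m a,
      forall L, \sum_(a <- ball L) weight a * m a <= C &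
      forall L M, \sum_(a <- ball L | (2 ^ M < size1 a)%N) weight a * m a
        <= C * rho ^+ M].

Lemma weight_gt0 a : Nstar d a -> 0 < weight a.
Proof. by move=> Na; rewrite powR_gt0 // ltr0n size1_gt0. Qed.

Lemma kernel_diag_gt0 a : Nstar d a -> 0 < K a a.
Proof.
move=> Na; apply: lt_le_trans (K_lower Na Na); rewrite mulr_gt0 // kernel_boundE //.
have a0 : 0 < (size1 a)%:R :> R by rewrite ltr0n size1_gt0.
by rewrite !mulr_gt0 ?powR_gt0 ?addr_gt0.
Qed.

Lemma approximants : exists (C : R) (u : nat -> P -> R), forall N,
  approximate_solution K s (2 ^ N) N.+1%:R^-1 (u N) /\ moment_bounds C (u N).
Proof.
have [C [C0 HC]] := uniform_tail gamma_p c1_gt0 K_ge0 K_sym K_lower mass_source.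
pose Z N : R := \sum_(a <- ball (2 ^ N)) (size1 a)%:R.
have Z0 N : 0 <= Z N by apply: sumr_ge0.
(* This serves two purposes: [e N * Z N <= 1] for the flux estimate, and an error at most 1/(N+1)
   for the limit. *)
pose e N : R := (N.+1%:R + Z N)^-1.
have D0 N : 0 < N.+1%:R + Z N by rewrite ltr_pwDl ?ltr0n.
have e0 N : 0 < e N by rewrite invr_gt0.
have eZ N : e N * Z N <= 1.
  by rewrite mulrC ler_pdivrMr // mul1r lerDr ler0n.
have eN N : e N <= N.+1%:R^-1 by rewrite lef_pV2 ?posrE ?ltr0n // lerDl.
have ex N : exists m, approximate_solution K s (2 ^ N) (e N) m.
  have NB := @lattice_ball_Nstar d (2 ^ N).
  have [|||||m [m0 mL mres]] :=
    @truncated_system R d (ball (2 ^ N)) K s (e N) (uniq_lattice_ball _ _).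
  - by move=> a /NB; rewrite size1_gt0.
  - by move=> a b /NB Na /NB Nb; exact: K_ge0.
  - by move=> a /NB; exact: kernel_diag_gt0.
  - by move=> a /NB; exact: s_ge0.
  - exact: e0.
  - by exists m.
have [u Hu] := choice ex.
exists C, u => N; have [u0 uL ures] := Hu N.
have wu0 a : 0 <= weight a * u N a by rewrite mulr_ge0 ?moment_weight_ge0.
have [tot tail] := HC N (e N) (u N) (eZ N) (Hu N).
split; first by split=> // a aL; apply: le_trans (ures a aL) (eN N).
split=> // [L|L M].
  apply: le_trans tot; apply: sum_off_support => //; try exact: uniq_lattice_ball.
  by move=> a /uL ->; rewrite mulr0.
apply: le_trans (tail M); rewrite big_mkcond [leRHS]big_mkcond /=.
apply: sum_off_support; try exact: uniq_lattice_ball.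
  by move=> a; case: ifP.
by move=> a /uL ->; rewrite mulr0 if_same.
Qed.

Lemma limit_exists (C : R) (u : nat -> P -> R) (F : set_system nat) :
  UltraFilter F ->
  (forall N, approximate_solution K s (2 ^ N) N.+1%:R^-1 (u N) /\
     moment_bounds C (u N)) ->
  exists n, (forall a, u N a @[N --> F] --> n a) /\ moment_bounds C n.
Proof.
move=> FU Hu.
have lim a : exists l : R, u N a @[N --> F] --> l.
  (* The origin lies in no ball, so all approximants vanish there; elsewhere the total moment bounds
     the coordinate. *)
  have [Na|Na] := boolP (a != 0); last first.
    apply: (@ultrafilter_bounded_cvg _ _ _ _ 0) => // N.
    have [[_ u0 _] _] := Hu N.
    by rewrite u0 ?lexx // mem_lattice_ball size1_gt0 (negPf Na).
  apply: (@ultrafilter_bounded_cvg _ _ _ _ (C / weight a)) => // N.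
  have [_ [u0 tot _]] := Hu N.
  rewrite u0 ler_pdivlMr ?weight_gt0 // mulrC; apply: le_trans (tot (size1 a)).
  apply: (@ler_term_sum _ _ (ball (size1 a)) a (fun a => weight a * u N a)).
    by rewrite mem_lattice_ball leqnn size1_gt0 Na.
  by move=> b _; rewrite mulr_ge0 ?moment_weight_ge0.
have [n nlim] := choice lim.
exists n; split=> //; split=> [a|L|L M].
- apply: (@cvgr_to_ge _ F _ _ (fun N => u N a)) => //.
  by apply: nearW => N; have [_ []] := Hu N.
- apply: (@cvgr_to_le _ F _ _ (fun N => \sum_(a <- ball L) weight a * u N a)).
    by apply: cvg_finite_sum => a; apply: cvgM => //; exact: cvg_cst.
  by apply: nearW => N; have [_ []] := Hu N.
- rewrite -big_filter.
  apply: (@cvgr_to_le _ F _ _ (fun N =>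
    \sum_(a <- [seq a <- ball L | (2 ^ M < size1 a)%N]) weight a * u N a)).
    by apply: cvg_finite_sum => a; apply: cvgM => //; exact: cvg_cst.
  by apply: nearW => N; rewrite big_filter; have [_ []] := Hu N.
Qed.

Section WeakLimit.
Variables (C : R) (u : nat -> P -> R) (n : P -> R) (F : set_system nat).
Hypothesis FF : ProperFilter F.
Hypothesis F_eventually : \oo `<=` F.
Hypothesis u_approx : forall N,
  approximate_solution K s (2 ^ N) N.+1%:R^-1 (u N) /\ moment_bounds C (u N).
Hypothesis u_lim : forall a, u N a @[N --> F] --> n a.
Hypothesis n_bounds : moment_bounds C n.
Variables (g : P -> R) (M0 : nat).
Hypothesis g_supp : forall a, (2 ^ M0 < size1 a)%N -> g a = 0.

Let block (M : nat) (m : P -> R) :=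
  \sum_(b <- ball (2 ^ M)) \sum_(c <- ball (2 ^ M)) pair_term K g m b c.

Let source := \sum_(a <- ball (2 ^ M0)) g a * s a.

Lemma moment_bound_ge0 : 0 <= C.
Proof.
have [n0 tot _] := n_bounds; apply: le_trans (tot 0%N).
by apply: sumr_ge0 => a _; rewrite mulr_ge0 ?moment_weight_ge0.
Qed.

Lemma block_sub M L (f : P -> P -> R) : (M <= L)%N ->
  \sum_(b <- ball (2 ^ M)) \sum_(c <- ball (2 ^ M)) f b c =
  \sum_(b <- ball (2 ^ L)) \sum_(c <- ball (2 ^ L))
    (if (size1 b <= 2 ^ M)%N && (size1 c <= 2 ^ M)%N then f b c else 0).
Proof.
move=> ML.
have sub : {subset ball (2 ^ M) <= ball (2 ^ L)}.
  by apply: lattice_ballS; rewrite leq_exp2l.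
have E (h : P -> R) : \sum_(b <- ball (2 ^ M)) h b =
    \sum_(b <- ball (2 ^ L)) (if (size1 b <= 2 ^ M)%N then h b else 0).
  rewrite (sum_uniq_mem _ (uniq_lattice_ball _ _) (uniq_lattice_ball _ _) sub).
  rewrite big_mkcond; apply: eq_big_seq => b; rewrite !mem_lattice_ball.
  by move=> /andP[-> _].
rewrite E; apply: eq_bigr => b _; rewrite E.
by case: (size1 b <= _)%N => //=; rewrite big1.
Qed.

Lemma source_ball M : (M0 <= M)%N ->
  \sum_(a <- ball (2 ^ M)) g a * s a = source.
Proof.
move=> MM; rewrite /source.
have sub : {subset ball (2 ^ M0) <= ball (2 ^ M)}.
  by apply: lattice_ballS; rewrite leq_exp2l.
rewrite (sum_uniq_mem _ (uniq_lattice_ball _ _) (uniq_lattice_ball _ _) sub).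
rewrite [RHS]big_mkcond; apply: eq_big_seq => a; rewrite !mem_lattice_ball.
move=> /andP[-> _] /=; case: (leqP (size1 a) (2 ^ M0)) => // aM.
by rewrite g_supp ?mul0r.
Qed.

(** For N at least M the equation for [u N] holds up to G/(N+1), and discarding the pairs outside
    the square of sizes up to 2^M costs a multiple of [rho ^+ M]. With M fixed the rest is a finite
    sum, which converges along [F]. *)
Lemma weak_limit : exists2 B, 0 <= B & forall M, (M0 <= M)%N ->
  (forall L, \sum_(b <- ball L) \sum_(c <- ball L)
    (if (size1 b <= 2 ^ M)%N && (size1 c <= 2 ^ M)%N then 0
     else `|pair_term K g n b c|) <= B * rho ^+ M) /\
  `|2^-1 * block M n + source| <= B * rho ^+ M.
Proof.
have [B B0 HB] := pair_term_tail c2_ge0 K_ge0 K_sym K_upper g_supp.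
have C0 := moment_bound_ge0; have r0 := ltW (decay_rate_gt0 gamma p).
(* One factor [C] bounds the tail moment, the other the total moment. *)
exists (B * (C * C)) => [|M MM]; first by rewrite !mulr_ge0.
set E := B * (C * C) * rho ^+ M.
have E0 : 0 <= E by rewrite !mulr_ge0 ?exprn_ge0.
have tail m L : moment_bounds C m ->
  \sum_(b <- ball L) \sum_(c <- ball L)
    (if (size1 b <= 2 ^ M)%N && (size1 c <= 2 ^ M)%N then 0
     else `|pair_term K g m b c|) <= E.
  move=> [m0 tot tl]; apply: le_trans (HB m M L m0 _) _; first by rewrite leq_exp2l.
  rewrite /E -!mulrA; apply: ler_wpM2l => //.
  rewrite [leRHS](_ : _ = C * rho ^+ M * C); last by ring.
  by apply: ler_pM => //; apply: sumr_ge0 => a _; rewrite mulr_ge0 ?moment_weight_ge0.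
split=> [L|]; first exact: tail.
pose G := \sum_(a <- ball (2 ^ M0)) `|g a|.
have gap N : (M <= N)%N -> `|2^-1 * block M (u N) + source| <= E + G / N.+1%:R.
  move=> MN; have [[u0 uL ures] ub] := u_approx N.
  have NB a : a \in ball (2 ^ N) -> Nstar d a by exact: lattice_ball_Nstar.
  have big_g b : (2 ^ N < size1 b)%N -> g b = 0.
    by move=> bN; apply: g_supp; apply: leq_ltn_trans bN; rewrite leq_exp2l // (leq_trans MM).
  have res : `|2^-1 * block N (u N) + source| <= G / N.+1%:R.
    have g_out b c : b \in ball (2 ^ N) -> c \in ball (2 ^ N) ->
        b + c \notin ball (2 ^ N) -> g (b + c) = 0.
      rewrite !mem_lattice_ball size1D => /andP[b0 _] _.
      by rewrite addn_gt0 b0 /= -ltnNge -size1D => /big_g.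
    have := weak_residual s (u N) (uniq_lattice_ball d (2 ^ N))
      (fun b c bL cL => K_sym (NB b bL) (NB c cL)) g_out.
    rewrite source_ball ?(leq_trans MM) // addrC /block /pair_term => <-.
    rewrite /G big_distrl /=; apply: le_trans (ler_norm_sum _ _ _) _.
    have -> : \sum_(a <- ball (2 ^ M0)) `|g a| / N.+1%:R =
      \sum_(a <- ball (2 ^ N)) (if (size1 a <= 2 ^ M0)%N then `|g a| / N.+1%:R else 0).
      have sub : {subset ball (2 ^ M0) <= ball (2 ^ N)}.
        by apply: lattice_ballS; rewrite leq_exp2l // (leq_trans MM).
      rewrite (sum_uniq_mem _ (uniq_lattice_ball _ _) (uniq_lattice_ball _ _) sub).
      rewrite big_mkcond; apply: eq_big_seq => a; rewrite !mem_lattice_ball.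
      by move=> /andP[-> _].
    apply: ler_sum_mem => a aL; rewrite normrM.
    case: leqP => aM; last by rewrite g_supp // normr0 mul0r.
    by apply: ler_wpM2l => //; exact: ures.
  have near : `|block N (u N) - block M (u N)| <= E.
    rewrite /block (block_sub _ MN) -sumrB.
    apply: le_trans (tail _ (2 ^ N)%N ub).
    apply: le_trans (ler_norm_sum _ _ _) _; apply: ler_sum => b _.
    rewrite -sumrB; apply: le_trans (ler_norm_sum _ _ _) _; apply: ler_sum => c _.
    by case: ifP; rewrite ?subrr ?normr0 ?subr0.
  move: res near; rewrite !ler_norml; set G' := G / _; lra.
have block_lim : block M (u N) @[N --> F] --> block M n.
  apply: cvg_finite_sum => b; apply: cvg_finite_sum => c.
  by apply: cvgM; [exact: cvg_cst|exact: cvgM].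
have lim : `|2^-1 * block M (u N) + source| @[N --> F] -->
    `|2^-1 * block M n + source|.
  apply: cvg_norm; apply: cvgD; last exact: cvg_cst.
  by apply: cvgM => //; exact: cvg_cst.
apply/ler_addgt0Pr => e e0.
apply: (@cvgr_to_le _ F _ _ (fun N => `|2^-1 * block M (u N) + source|)) => //.
have [N0 HN0] := invn_eventually G e0.
apply: F_eventually; exists (maxn M N0) => // N /=; rewrite geq_max => /andP[MN NN].
by apply: le_trans (gap N MN) _; rewrite lerD2l HN0.
Qed.

End WeakLimit.

End Existence.

(** * From the lattice estimates to the weak equation *)

Section LatticePairs.
Variables (d : nat).
Local Notation P := 'rV[nat]_d.

Definition ball_pairs (L : nat) : seq (P * P) :=
  [seq (b, c) | b <- lattice_ball d L, c <- lattice_ball d L].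

Lemma mem_ball_pairs L x : (x \in ball_pairs L) =
  (x.1 \in lattice_ball d L) && (x.2 \in lattice_ball d L).
Proof.
apply/allpairsP/andP => [[y [y1 y2 ->]]|[x1 x2]]; first by split.
by exists x; rewrite -surjective_pairing.
Qed.

Lemma uniq_ball_pairs L : uniq (ball_pairs L).
Proof.
by apply: allpairs_uniq; rewrite ?uniq_lattice_ball // => -[a b] [a' b'] _ _ [-> ->].
Qed.

Lemma seq_sub_ball (r : seq P) : (forall a, a \in r -> Nstar d a) ->
  exists L, {subset r <= lattice_ball d L}.
Proof.
move=> rN; exists (\sum_(a <- r) size1 a)%N => a ar.
by rewrite mem_lattice_ball size1_gt0 rN //= (big_rem a) //= leq_addr.
Qed.

End LatticePairs.

(** Compactness bounds the support by some [M] in the maximum norm, so the size of a lattice point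
    in it is at most d times [M]. *)
Lemma compact_support_lattice (R : realType) (d : nat) (phi : 'rV[R]_d -> R) :
  compact_support_in (Rstar R d) phi ->
  exists Y, forall a, (Y < size1 a)%N -> phi (lattice_pt R a) = 0.
Proof.
move=> [/compact_bounded bS _].
have [M M0 HM] := pinfty_ex_gt (real0 R) bS.
exists (Num.trunc (d%:R * M)) => a aM; apply: contraTeq aM => phia.
rewrite -leqNgt; have [->|a0] := posnP (size1 a); first exact: leq0n.
have star : Rstar R d (lattice_pt R a).
  split=> [j|]; first by rewrite mxE ler0n.
  apply: contraTneq a0 => az; rewrite size1_gt0 negbK.
  apply/eqP; apply/rowP => j.
  by have /(congr1 (fun v => v 0 j)) := az; rewrite !mxE => /eqP; rewrite pnatr_eq0 => /eqP.
have aM : `|lattice_pt R a| <= M by apply: HM; exact: subset_closure.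
have coordM j : (a 0 j)%:R <= M.
  apply: le_trans aM; rewrite /Num.norm /= mx_normrE.
  by apply: (bigmax_sup (0, j)) => //=; rewrite mxE normr_nat.
rewrite -ltnS -(ltr_nat R); apply: le_lt_trans (truncnS_gt _).
rewrite /size1 natr_sum; apply: le_trans (ler_sum _ (fun j _ => coordM j)) _.
by rewrite sumr_const card_ord mulr_natl.
Qed.

Lemma finite_source_mass (R : realType) (d : nat) (s : 'rV[nat]_d -> R) :
  (forall a, Nstar d a -> 0 <= s a) ->
  finite_set [set a | Nstar d a /\ s a != 0] ->
  exists J, forall L, \sum_(a <- lattice_ball d L) (size1 a)%:R * s a <= J.
Proof.
move=> s0 /finite_seqP[r rE].
have rP a : (a \in r) = (a != 0) && (s a != 0).
  apply/idP/andP => [ar|ha].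
    by have : [set` r] a by []; rewrite -rE => -[].
  by have : [set` r] a by rewrite -rE.
exists (\sum_(a <- undup r) (size1 a)%:R * s a) => L.
rewrite (bigID (mem r)) /= [X in _ + X]big1_seq ?addr0; last first.
  move=> a /andP[ar /lattice_ball_Nstar Na]; move: ar; rewrite rP Na /= negbK.
  by move=> /eqP ->; rewrite mulr0.
rewrite -big_filter; apply: ler_sum_sub.
- by rewrite filter_uniq ?uniq_lattice_ball.
- exact: undup_uniq.
- by move=> a; rewrite mem_filter mem_undup => /andP[].
- by move=> a; rewrite mem_undup rP => /andP[Na _]; rewrite mulr_ge0 ?s0.
Qed.

Unset Implicit Arguments.

Theorem theorem3p2 (R : realType) (d : nat) (hd : (1 <= d)%N)
  (gamma p : R) (hgp : gamma + 2 * p < 1)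
  (c1 c2 : R) (hc1 : 0 < c1) (hc12 : c1 <= c2)
  (K : 'rV[nat]_d -> 'rV[nat]_d -> R)
  (K_ge0 : forall a b, Nstar d a -> Nstar d b -> 0 <= K a b)
  (K_sym : forall a b, Nstar d a -> Nstar d b -> K a b = K b a)
  (K_bound : forall a b, Nstar d a -> Nstar d b ->
     c1 * kernel_bound gamma p a b <= K a b <= c2 * kernel_bound gamma p a b)
  (s : 'rV[nat]_d -> R)
  (s_ge0 : forall a, Nstar d a -> 0 <= s a)
  (s_fin : finite_set [set a | Nstar d a /\ s a != 0]) :
  exists n : 'rV[nat]_d -> R,
    stationary_injection_solution K gamma p s n.
Proof.
have c2_ge0 : 0 <= c2 by apply: le_trans hc12; exact: ltW.
have K_lower a b : Nstar d a -> Nstar d b -> c1 * kernel_bound gamma p a b <= K a b.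
  by move=> Na Nb; have /andP[] := K_bound a b Na Nb.
have K_upper a b : Nstar d a -> Nstar d b -> K a b <= c2 * kernel_bound gamma p a b.
  by move=> Na Nb; have /andP[] := K_bound a b Na Nb.
have [J massJ] := finite_source_mass s_ge0 s_fin.
have [C [u Hu]] := approximants hgp hc1 K_ge0 K_sym K_lower s_ge0 massJ.
(* An ultrafilter refining convergence to infinity: limits along it exist for bounded sequences and
   inherit bounds valid for all large N. *)
have [F [FU Foo]] := ultraFilterLemma eventually_filter.
have [n [nlim nb]] := limit_exists FU Hu.
have [n0 ntot _] := nb.
exists n; split=> [a _ //||phi [_ /compact_support_lattice[Y phiY]]].
  apply: le_lt_trans (_ : (_ <= C%:E)%E) (ltry _).
  apply: esum_le_seq => r ur rN; have [L rL] := seq_sub_ball rN.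
  apply: le_trans (ntot L); apply: ler_sum_sub => //; first exact: uniq_lattice_ball.
  by move=> a _; rewrite mulr_ge0 ?powR_ge0.
pose g a := phi (lattice_pt R a).
(* Since Y < 2^Y, the exponent [Y] itself gives a dyadic cutoff. *)
have g_supp a : (2 ^ Y < size1 a)%N -> g a = 0.
  by move=> aY; apply: phiY; apply: ltn_trans aY; exact: ltn_expl.
have [B B0 HB] := weak_limit c2_ge0 K_ge0 K_sym K_upper
  (@ultra_proper _ _ FU) Foo Hu nlim nb g_supp.
have coagE ab : coag_term K n phi ab = pair_term K g n ab.1 ab.2.
  by case: ab => a b; rewrite /coag_term /pair_term mulrA.
pose pairs M := ball_pairs d (2 ^ M).
(* Finitely many pairs outside the square of sizes up to 2^M fit into a larger square, on which the
   tail bound does not depend on its side. *)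
have approx M : (Y <= M)%N ->
    summable (Nstar d `*` Nstar d) (EFin \o coag_term K n phi) /\
    `|rsum (Nstar d `*` Nstar d) (coag_term K n phi) -
      \sum_(ab <- pairs M) coag_term K n phi ab| <= B * decay_rate gamma p ^+ M.
  move=> YM; have [tail _] := HB M YM; apply: rsum_approx.
  - exact: uniq_ball_pairs.
  - by move=> x; rewrite mem_ball_pairs => /andP[/lattice_ball_Nstar ? /lattice_ball_Nstar ?].
  move=> r ur rD.
  have [L1 rL1] : exists L, {subset map fst r <= lattice_ball d L}.
    by apply: seq_sub_ball => a /mapP[x /rD[[xN _] _] ->].
  have [L2 rL2] : exists L, {subset map snd r <= lattice_ball d L}.
    by apply: seq_sub_ball => a /mapP[x /rD[[_ xN] _] ->].
  pose L := maxn L1 L2.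
  pose h (x : 'rV[nat]_d * 'rV[nat]_d) : R :=
    if (size1 x.1 <= 2 ^ M)%N && (size1 x.2 <= 2 ^ M)%N then 0
    else `|pair_term K g n x.1 x.2|.
  have hE : \sum_(x <- ball_pairs d L) h x <= B * decay_rate gamma p ^+ M.
    by rewrite big_allpairs; exact: tail.
  apply: le_trans hE; apply: le_trans (_ : \sum_(x <- r) h x <= _).
    apply: ler_sum_mem => x /rD[[/= x1 x2]]; rewrite mem_ball_pairs !mem_lattice_ball.
    by rewrite !size1_gt0 x1 x2 /h coagE /= => /negPf ->.
  apply: ler_sum_sub => //; first exact: uniq_ball_pairs.
    move=> x xr; rewrite mem_ball_pairs; apply/andP; split.
      by apply: (lattice_ballS (leq_maxl L1 L2)); apply: rL1; exact: map_f.
    by apply: (lattice_ballS (leq_maxr L1 L2)); apply: rL2; exact: map_f.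
  by move=> x _; rewrite /h; case: ifP.
split; first by have [] := approx Y (leqnn Y).
have -> : \sum_(a \in Nstar d) phi (lattice_pt R a) * s a =
    \sum_(a <- lattice_ball d (2 ^ Y)) g a * s a.
  rewrite [RHS]fsbig_seq ?uniq_lattice_ball //; apply/esym; apply: fsbig_widen.
    by move=> a /= /lattice_ball_Nstar.
  move=> a [Na /= aB]; rewrite g_supp ?mul0r // ltnNge.
  by apply/negP => aY; apply: aB; rewrite mem_lattice_ball size1_gt0 Na.
(* The left-hand quantity does not depend on M. Replacing the series by its square sum costs half of
   [B] times the M-th power of the rate, and [weak_limit] costs [B] times that power; twice [B]
   covers both, and the power tends to 0. *)
apply/esym/eqP; rewrite -normr_le0; apply/ler_addgt0Pr => e e0; rewrite add0r.
have rho1 : `|decay_rate gamma p| < 1.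
  by rewrite ger0_norm ?decay_rate_lt1 // ltW ?decay_rate_gt0.
have : 2 * B * decay_rate gamma p ^+ M @[M --> \oo] --> 2 * B * 0.
  by apply: cvgM; [exact: cvg_cst|exact: cvg_expr].
rewrite mulr0 => /cvgr_le/(_ e e0)[M1 _ HM1].
pose M := maxn Y M1; have YM : (Y <= M)%N by exact: leq_maxl.
apply: le_trans (HM1 M (leq_maxr _ _)); rewrite /=.
have [_] := approx M YM; have [_] := HB M YM.
rewrite /pairs big_allpairs.
have -> : \sum_(b <- lattice_ball d (2 ^ M)) \sum_(c <- lattice_ball d (2 ^ M))
    coag_term K n phi (b, c) =
  \sum_(b <- lattice_ball d (2 ^ M)) \sum_(c <- lattice_ball d (2 ^ M))
    pair_term K g n b c.
  by apply: eq_bigr => b _; apply: eq_bigr => c _; rewrite coagE.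
by rewrite !ler_norml; lra.
Qed.
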